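(* Let $D$ be a Jordan domain in $\mathbb C$ and let $\lambda:\partial D\to\mathbb C$ with $|\lambda(\zeta)|=1$ for all $\zeta$, and $\varphi:\partial D\to\mathbb R$ be functions measurable with respect to harmonic measures in $D$. Let $S$ be the set of all analytic functions $f:D\to\mathbb C$ such that for almost every $\zeta\in\partial D$ with respect to harmonic measures in $D$, the function $z\mapsto\mathrm{Re}\,\{\overline{\lambda(\zeta)}\cdot f(z)\}$ has a unique principal asymptotic value at $\zeta$, equal to $\varphi(\zeta)$. Then $S$ has infinite dimension, i.e. the real linear span of the differences $f_1-f_2$, $f_1,f_2\in S$, is infinite-dimensional.
   Context: Let $\omega:D\to\mathbb D$ be a conformal map onto the unit disk, extended (by Carathéodory's theorem) to a homeomorphism $\overline D\to\overline{\mathbb D}$. A set $\mathcal E\subseteq\partial D$ is measurable with respect to harmonic measures in $D$ if $\omega(\mathcal E)$ is Lebesgue measurable on $\partial\mathbb D$; it has harmonic measure zero if $|\omega(\mathcal E)|=0$; a function $\psi$ on $\partial D$ is measurable with respect to harmonic measures if $\psi\circ\omega^{-1}$ is Lebesgue measurable on $\partial\mathbb D$, and ''almost every with respect to harmonic measures'' means outside a set of harmonic measure zero. For $\Omega:D\to\overline{\mathbb C}$, $\zeta\in\partial D$ and an arc $\gamma$ in $D$ terminating at $\zeta$, $C(\Omega,\gamma)=\{w\in\overline{\mathbb C}: \Omega(z_n)\to w \text{ for some } z_n\in\gamma,\ z_n\to\zeta\}$; the set of principal asymptotic values is $P(\Omega,\zeta)=\bigcap_\gamma C(\Omega,\gamma)$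 over all arcs $\gamma$ in $D$ terminating at $\zeta$. ''Unique principal asymptotic value equal to $c$'' means $P(\Omega,\zeta)=\{c\}$. The set $S$ is a real affine space; its dimension is that of the real linear space spanned by differences of its elements. *)

(* Defs.v *)
From HB Require Import structures.
From mathcomp Require Import all_boot all_order all_algebra.
From mathcomp Require Import all_classical all_reals all_analysis.
From mathcomp Require Import complex.
Set Implicit Arguments. Unset Strict Implicit. Unset Printing Implicit Defensive.
Import Order.TTheory GRing.Theory Num.Theory.
Import numFieldNormedType.Exports.
Local Open Scope classical_set_scope.
Local Open Scope ring_scope.
Local Open Scope complex_scope.

(* The complex plane, seen as a normed module over itself
   (so that [derivable] is complex differentiability). *)
Notation Cplx R := ((R[i])^o).

Section Defs.
Variable R : realType.
Local Notation C := (Cplx R).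

Definition holomorphic_on (D : set C) (f : C -> C) : Prop :=
  forall z, D z -> derivable f z 1.

Definition open_disk : set C := [set w : C | `|w| < 1].
Definition closed_disk : set C := [set w : C | `|w| <= 1].

(* boundary of a domain (D open) *)
Definition bdry (D : set C) : set C := closure D `\` D.

Definition jordan_curve (g : R -> C) : Prop :=
  {within `[0, 1], continuous g} /\ g 0 = g 1 /\
  (forall s t, 0 <= s < 1 -> 0 <= t < 1 -> g s = g t -> s = t).

Definition jordan_domain (D : set C) : Prop :=
  exists g : R -> C, jordan_curve g /\
  exists z0 : C, ~ (g @` `[0, 1]) z0 /\
    D = connected_component (~` (g @` `[0, 1])) z0 /\ bounded_set D.

Definition caratheodory_conformal_map (D : set C) (w : C -> C) : Prop :=
  holomorphic_on D w /\
  w @` D = open_disk /\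
  w @` closure D = closed_disk /\
  (forall z1 z2, closure D z1 -> closure D z2 -> w z1 = w z2 -> z1 = z2) /\
  {within closure D, continuous w} /\
  exists w' : C -> C, (forall z, closure D z -> w' (w z) = z) /\
    {within closed_disk, continuous w'}.

Definition lebesgue_measurable (A : set R) : Prop :=
  exists B : set R, measurable B /\
    (@lebesgue_measure R).-negligible ((A `\` B) `|` (B `\` A)).

(* arc-length parametrization of the unit circle: A subset of the circle
   corresponds to {t in [0, 2 pi) | e^{it} in A} *)
Definition circle_pullback (A : set C) : set R :=
  [set t : R | 0 <= t < 2 * pi /\ A ((cos t) +i* (sin t))].

(* Harmonic-measure notions in D, defined through w *)
Definition hm_measurable_set (w : C -> C) (E : set C) : Prop :=
  lebesgue_measurable (circle_pullback (w @` E)).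

Definition hm_null_set (w : C -> C) (E : set C) : Prop :=
  (@lebesgue_measure R).-negligible (circle_pullback (w @` E)).

Definition hm_measurable_fun (T : topologicalType) (D : set C) (w : C -> C)
    (psi : C -> T) : Prop :=
  forall U : set T, open U ->
    hm_measurable_set w [set z | bdry D z /\ U (psi z)].

(* Extended complex plane: [Some a] is the finite point a, [None] is infinity.
   Convergence of a sequence in the extended plane. *)
Definition ext_cvg (u : nat -> C) (v : option C) : Prop :=
  match v with
  | Some a => u @ \oo --> a
  | None => forall M : R, \forall n \near \oo, (M%:C : C) < `|u n|
  end.

Definition arc_to (D : set C) (zeta : C) (gamma : R -> C) : Prop :=
  {within `[0, 1[, continuous gamma} /\
  (forall s t, 0 <= s < 1 -> 0 <= t < 1 -> gamma s = gamma t -> s = t) /\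
  (forall t, 0 <= t < 1 -> D (gamma t)) /\
  gamma t @[t --> 1^'-] --> zeta.

Definition cluster_set_along (Om : C -> C) (zeta : C) (gamma : R -> C)
    : set (option C) :=
  [set v | exists z : nat -> C,
     (forall n, (gamma @` `[0, 1[) (z n)) /\ z @ \oo --> zeta /\
     ext_cvg (Om \o z) v].

Definition principal_asymptotic_values (D : set C) (Om : C -> C) (zeta : C)
    : set (option C) :=
  [set v | forall gamma, arc_to D zeta gamma -> cluster_set_along Om zeta gamma v].

Definition S_set (D : set C) (w : C -> C) (lam : C -> C) (phi : C -> R)
    : set (C -> C) :=
  [set f | holomorphic_on D f /\
     exists E : set C, E `<=` bdry D /\ hm_null_set w E /\
       forall zeta, bdry D zeta -> ~ E zeta ->
         principal_asymptotic_values D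
           (fun z => ((complex.Re (conjc (lam zeta) * f z))%:C : C)) zeta
         = [set Some ((phi zeta)%:C : C)]].

(* The real linear span of {f1 - f2 | f1, f2 in S} (functions on D, i.e.
   compared on D) is infinite-dimensional: it is not spanned by finitely
   many functions. *)
Definition infinite_dimensional_affine (D : set C) (S : set (C -> C)) : Prop :=
  ~ exists (n : nat) (g : 'I_n -> C -> C),
      forall f1 f2, S f1 -> S f2 ->
        exists c : 'I_n -> R,
          forall z, D z -> f1 z - f2 z = \sum_(i < n) (c i)%:C * g i z.

End Defs.

(* Main.v *)
(* Everything is transported to the unit disk, where a solution is any analytic [F]
   whose radial limits [psi] satisfy [Re (conj lam * psi) = phi] almost everywhere;
   the imaginary part of [conj lam * psi] is free, which gives infinitely many
   independent solutions once every measurable [psi] is known to be a radial limit.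

   Radial limits.  Pushing the pole of [z / (z - d)] along the positive axis gives a
   polynomial [G] with [G 0 = 0], close to [1] on the unit circle off a short arc,
   and bounded off a narrow sector.  Hence every measurable [psi] is a limit in
   measure of analytic polynomials: [G(z) / z] approximates the conjugate of [z].
   Given a polynomial [P] and a polynomial [p] approximating [psi - P], the
   correction [p(z) G(z^m)] is, for large [m], tiny on a given smaller disk, close
   to [p] on most of the circle, and bounded by [p] on most radii; summing such
   corrections yields [F], the partial sums converging uniformly on the radii ending
   in sets [A_N] that exhaust the circle up to a null set.

   Principal values.  If [t] is a two-sided limit point of [A_N], every arc ending at
   [e^it] meets, arbitrarily close to its end, radii ending in [A_N] near [t] (by the
   intermediate value theorem); so [psi t] is a cluster value along every arc,
   while it is the only one along the radius itself. *)
Require Import Defs.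
From HB Require Import structures.
From mathcomp Require Import all_boot all_order all_algebra.
From mathcomp Require Import all_classical all_reals all_analysis measurable_realfun.
From mathcomp Require Import complex ring lra.
Import Order.TTheory GRing.Theory Num.Theory.
Import numFieldNormedType.Exports.
Local Open Scope classical_set_scope.
Local Open Scope ring_scope.
Local Open Scope complex_scope.

Set Implicit Arguments.
Unset Strict Implicit.
Unset Printing Implicit Defensive.

(* The modulus as an element of [R]; the library's [`|z|] lives in [R[i]]. *)
Local Notation nm := Normc.normc.

(** * Modulus and coefficient majorants of polynomials *)

Section ComplexModulus.
Context {R : realType}.
Implicit Types x y z : R[i].

Lemma nmE z : `|z| = (nm z)%:C.
Proof. by case: z. Qed.

Lemma nm_ge0 z : 0 <= nm z.
Proof. by case: z => a b; exact: sqrtr_ge0. Qed.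

Lemma nmM x y : nm (x * y) = nm x * nm y.
Proof. exact: Normc.normcM. Qed.

Lemma nm0 : nm (0 : R[i]) = 0.
Proof. exact: Normc.normc0. Qed.

Lemma nm1 : nm (1 : R[i]) = 1.
Proof. exact: Normc.normc1. Qed.

Lemma nmD x y : nm (x + y) <= nm x + nm y.
Proof. exact: le_normcD. Qed.

Lemma nmN x : nm (- x) = nm x.
Proof. exact: normcN. Qed.

Lemma nmBC x y : nm (x - y) = nm (y - x).
Proof. by rewrite -opprB nmN. Qed.

Lemma nmB x y : nm (x - y) <= nm x + nm y.
Proof. by rewrite (le_trans (nmD _ _))// nmN. Qed.

Lemma nm_tri y x z : nm (x - z) <= nm (x - y) + nm (y - z).
Proof. by rewrite -[x - z](subrKA y) nmD. Qed.

Lemma nm_eq0 z : (nm z == 0) = (z == 0).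
Proof.
apply/eqP/eqP => [|->]; first exact: Normc.eq0_normc.
exact: nm0.
Qed.

Lemma nmV x : nm x^-1 = (nm x)^-1.
Proof. exact: Normc.normcV. Qed.

Lemma nmX x n : nm (x ^+ n) = nm x ^+ n.
Proof. by elim: n => [|n ih]; rewrite ?expr0 ?nm1// !exprS nmM ih. Qed.

Lemma nmR (a : R) : nm a%:C = `|a|.
Proof. by rewrite /nm /= expr0n/= addr0 sqrtr_sqr. Qed.

Lemma sqr_nm z : nm z ^+ 2 = complex.Re z ^+ 2 + complex.Im z ^+ 2.
Proof. by case: z => a b; rewrite sqr_sqrtr// addr_ge0// sqr_ge0. Qed.

Lemma Re_le_nm z : `|complex.Re z| <= nm z.
Proof.
rewrite -(@ler_pXn2r _ 2) ?nnegrE ?nm_ge0// sqr_nm real_normK ?num_real//.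
by rewrite lerDl sqr_ge0.
Qed.

Lemma Im_le_nm z : `|complex.Im z| <= nm z.
Proof.
rewrite -(@ler_pXn2r _ 2) ?nnegrE ?nm_ge0// sqr_nm real_normK ?num_real//.
by rewrite lerDr sqr_ge0.
Qed.

Lemma nm_le_ReIm z : nm z <= `|complex.Re z| + `|complex.Im z|.
Proof.
case: z => a b; rewrite (_ : a +i* b = a%:C + b%:C * 'i); last by simpc.
rewrite (le_trans (nmD _ _))// nmM !nmR /= lerD//=; first by simpc.
by rewrite expr0n/= expr1n add0r sqrtr1 mulr1; simpc.
Qed.

Lemma nm_sub_le x y : nm x - nm y <= nm (x - y).
Proof. by rewrite lerBlDr -{1}[x](subrK y) nmD. Qed.

End ComplexModulus.

#[local] Arguments Normc.normc : simpl never.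

Section PolynomialMajorant.
Context {R : realType}.
Implicit Types (P Q : {poly R[i]}) (s d : R).

(** Replaces the supremum of [P] on the disk of radius [s]. It is an explicit finite sum, increasing
    in [s] and submultiplicative, so Cauchy-type estimates reduce to inductions on the Horner
    form. *)
Definition majorant P s := \sum_(i < size P) nm P`_i * s ^+ i.

Lemma majorantE P s n : (size P <= n)%N ->
  majorant P s = \sum_(i < n) nm P`_i * s ^+ i.
Proof.
move=> Pn; rewrite /majorant (big_ord_widen n (fun i => nm P`_i * s ^+ i))//.
rewrite big_mkcond/=; apply: eq_bigr => i _; case: ifPn => //.
by rewrite -leqNgt => iP; rewrite nth_default// nm0 mul0r.
Qed.

Lemma majorant_ge0 P s : 0 <= s -> 0 <= majorant P s.
Proof. by move=> s0; apply: sumr_ge0 => i _; rewrite mulr_ge0 ?nm_ge0 ?exprn_ge0. Qed.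

Lemma majorantD P Q s : 0 <= s -> majorant (P + Q) s <= majorant P s + majorant Q s.
Proof.
move=> s0; set n := maxn (size P) (size Q).
rewrite !(@majorantE _ _ n) ?leq_maxl ?leq_maxr ?size_polyD// -big_split/=.
by apply: ler_sum => i _; rewrite coefD -mulrDl ler_wpM2r ?exprn_ge0 ?nmD.
Qed.

Lemma majorantC c s : majorant c%:P s = nm c.
Proof.
rewrite (@majorantE _ _ 1) ?size_polyC_leq1// big_ord1 coefC/= expr0.
by rewrite mulr1.
Qed.

Lemma majorant_scale c P s : majorant (c *: P) s = nm c * majorant P s.
Proof.
rewrite (@majorantE _ _ (size P)) ?size_scale_leq// mulr_sumr.
by apply: eq_bigr => i _; rewrite coefZ nmM mulrA.
Qed.

Lemma majorantMXaddC P c s : majorant (P * 'X + c%:P) s = majorant P s * s + nm c.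
Proof.
rewrite (@majorantE _ _ (size P).+1); last first.
  by rewrite size_MXaddC; case: ifP.
rewrite big_ord_recl/= expr0 mulr1 addrC coefD coefMX coefC/= add0r; congr (_ + _).
rewrite /majorant mulr_suml; apply: eq_bigr => i _.
by rewrite coefD coefMX coefC/= addr0 /bump/= add1n exprSr mulrA.
Qed.

Lemma majorantMX P s : majorant (P * 'X) s = majorant P s * s.
Proof. by rewrite -[P * 'X]addr0 -polyC0 majorantMXaddC nm0 addr0. Qed.

Lemma majorantM P Q s : 0 <= s -> majorant (P * Q) s <= majorant P s * majorant Q s.
Proof.
move=> s0; elim/poly_ind: P => [|P c ih].
  by rewrite mul0r -polyC0 majorantC nm0 mul0r.
rewrite mulrDl mulrAC mul_polyC (le_trans (majorantD _ _ s0))//.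
rewrite majorantMX majorant_scale majorantMXaddC mulrDl lerD2r.
by rewrite mulrAC ler_wpM2r.
Qed.

Lemma majorant_XnM P m s : majorant ('X^m * P) s = s ^+ m * majorant P s.
Proof.
elim: m => [|m ih]; first by rewrite !expr0 !mul1r.
by rewrite exprSr -mulrA ['X * P]mulrC mulrA majorantMX ih exprS; ring.
Qed.

(** The bound is uniform in [m], so the exponent in [approximation_step] can be chosen after the
    polynomial being composed. *)
Lemma majorant_comp_Xn P m s : 0 <= s -> s <= 1 ->
  majorant (P \Po 'X^m) s <= majorant P 1.
Proof.
move=> s0 s1; elim/poly_ind: P => [|P c ih].
  by rewrite comp_poly0 -polyC0 !majorantC.
rewrite comp_polyD comp_polyM comp_polyX comp_polyC majorantMXaddC mulr1.
rewrite (le_trans (majorantD _ _ s0))// majorantC lerD2r mulrC majorant_XnM.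
rewrite -[leRHS]mul1r ler_pM ?exprn_ge0 ?majorant_ge0//.
by rewrite exprn_ile1.
Qed.

Lemma nm_horner_le P z s : nm z <= s -> nm P.[z] <= majorant P s.
Proof.
move=> zs; have s0 : 0 <= s by rewrite (le_trans (nm_ge0 z)).
elim/poly_ind: P => [|P c ih]; first by rewrite horner0 nm0 majorant_ge0.
rewrite hornerMXaddC majorantMXaddC (le_trans (nmD _ _))// lerD2r nmM.
by rewrite ler_pM ?nm_ge0.
Qed.

(** A Cauchy estimate for the derivative, obtained coefficientwise: by the binomial formula
    [i * s ^+ i.-1 * d] is at most [(s + d) ^+ i]. The induction on the Horner form carries this
    out. *)
Lemma nm_deriv_le P z s d : nm z <= s -> 0 < d ->
  nm P^`().[z] * d <= majorant P (s + d).
Proof.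
move=> zs d0; have s0 : 0 <= s by rewrite (le_trans (nm_ge0 z)).
have sd0 : 0 <= s + d by rewrite addr_ge0// ltW.
elim/poly_ind: P => [|P c ih].
  by rewrite deriv0 horner0 nm0 mul0r majorant_ge0.
rewrite derivD derivC addr0 derivM derivX mulr1 majorantMXaddC.
rewrite hornerD hornerMX.
apply: (@le_trans _ _ ((nm P^`().[z] * nm z + nm P.[z]) * d)).
  by rewrite ler_wpM2r ?(ltW d0)// (le_trans (nmD _ _))// nmM.
have h1 : nm P.[z] <= majorant P (s + d) by apply: nm_horner_le; lra.
have h2 : nm P^`().[z] * d * nm z <= majorant P (s + d) * s.
  by rewrite ler_pM ?nm_ge0// mulr_ge0 ?nm_ge0// ltW.
have h3 : nm P.[z] * d <= majorant P (s + d) * d by rewrite ler_wpM2r// ltW.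
by have := nm_ge0 c; lra.
Qed.

Lemma nm_taylor_le P x y s d : nm x <= s -> nm y <= s -> 0 < d ->
  nm (P.[x] - P.[y] - P^`().[y] * (x - y)) * d ^+ 2
    <= majorant P (s + d) * nm (x - y) ^+ 2.
Proof.
move=> xs ys d0; have s0 : 0 <= s by rewrite (le_trans (nm_ge0 x)).
have sd0 : 0 <= s + d by rewrite addr_ge0// ltW.
elim/poly_ind: P => [|P c ih].
  rewrite deriv0 !horner0 mul0r !subr0 nm0 mul0r.
  by rewrite mulr_ge0 ?majorant_ge0// exprn_ge0 ?nm_ge0.
rewrite derivD derivC addr0 derivM derivX mulr1 majorantMXaddC.
rewrite !hornerMXaddC hornerD hornerMX.
set E := P.[x] - _ - _ in ih.
(* The Taylor remainder of [P * 'X + c] is [x] times that of [P] plus a quadratic term, and the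
   latter is bounded by [nm_deriv_le]. *)
rewrite [X in nm X](_ : _ = x * E + P^`().[y] * (x - y) ^+ 2); last by rewrite /E; ring.
apply: (@le_trans _ _ ((nm x * nm E + nm P^`().[y] * nm (x - y) ^+ 2) * d ^+ 2)).
  by rewrite ler_wpM2r ?sqr_ge0// (le_trans (nmD _ _))// -nmX !nmM.
have h1 : (nm P^`().[y] * d) * (d * nm (x - y) ^+ 2)
   <= majorant P (s + d) * (d * nm (x - y) ^+ 2).
  by rewrite ler_wpM2r ?nm_deriv_le// mulr_ge0 ?sqr_ge0// ltW.
have h2 : (nm E * d ^+ 2) * nm x <= (majorant P (s + d) * nm (x - y) ^+ 2) * s.
  by rewrite ler_pM ?nm_ge0// mulr_ge0 ?nm_ge0// sqr_ge0.
have h3 : 0 <= nm c * nm (x - y) ^+ 2 by rewrite mulr_ge0 ?nm_ge0 ?sqr_ge0.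
by lra.
Qed.

End PolynomialMajorant.

(** * Pole pushing *)

Section PolynomialApproximation.
Context {R : realType}.
Implicit Types (U : set R[i]) (f g : R[i] -> R[i]) (c d e : R).

Lemma expr_small (q : R) e : 0 <= q -> q < 1 -> 0 < e ->
  exists n0, forall n, (n0 <= n)%N -> q ^+ n <= e.
Proof.
move=> q0 q1 e0; have /cvgrPdist_le/(_ e e0)[n0 _ H] : q ^+ n @[n --> \oo] --> 0.
  by apply: cvg_expr; rewrite ger0_norm.
exists n0 => n n0n; have := H n n0n.
by rewrite sub0r normrN ger0_norm// exprn_ge0.
Qed.

Definition poly_approximable U f := forall e, 0 < e ->
  exists p : {poly R[i]}, forall z, U z -> nm (f z - p.[z]) <= e.

Lemma poly_approximable_horner U (p : {poly R[i]}) :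
  poly_approximable U (horner p).
Proof. by move=> e e0; exists p => z _; rewrite subrr nm0 ltW. Qed.

Lemma eq_poly_approximable U f g : (forall z, U z -> f z = g z) ->
  poly_approximable U f -> poly_approximable U g.
Proof.
by move=> fg fa e /fa[p pf]; exists p => z Uz; rewrite -fg// pf.
Qed.

Lemma poly_approximableD U f g :
  poly_approximable U f -> poly_approximable U g ->
  poly_approximable U (fun z => f z + g z).
Proof.
move=> fa ga e e0; have e2 : 0 < e / 2 by rewrite divr_gt0.
have [p pf] := fa _ e2; have [q qg] := ga _ e2.
exists (p + q) => z Uz; rewrite hornerD.
rewrite [X in nm X](_ : _ = (f z - p.[z]) + (g z - q.[z])); last by ring.
by rewrite (le_trans (nmD _ _))// (splitr e) lerD ?pf ?qg.
Qed.

Lemma poly_approximable_bounded U f : (forall z, U z -> nm z <= 1) ->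
  poly_approximable U f -> exists2 M, 0 < M & forall z, U z -> nm (f z) <= M.
Proof.
move=> U1 /(_ 1 ltr01)[p pf]; exists (1 + majorant p 1).
  by rewrite ltr_pwDl// majorant_ge0.
move=> z Uz; rewrite -[f z](subrK p.[z]) (le_trans (nmD _ _))// lerD ?pf//.
by rewrite nm_horner_le// U1.
Qed.

Lemma poly_approximableM U f g : (forall z, U z -> nm z <= 1) ->
  poly_approximable U f -> poly_approximable U g ->
  poly_approximable U (fun z => f z * g z).
Proof.
move=> U1 fa ga e e0.
have [M M0 fM] := poly_approximable_bounded U1 fa.
have e1 : 0 < e / 2 / M by rewrite !divr_gt0.
(* The second factor is approximated first, so that the tolerance for [f] can be measured against
   the majorant of [q]. *)
have [q qg] := ga _ e1.
have K0 : 0 < 1 + majorant q 1 by rewrite ltr_pwDl// majorant_ge0.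
have e2 : 0 < e / 2 / (1 + majorant q 1) by rewrite !divr_gt0.
have [p pf] := fa _ e2.
exists (p * q) => z Uz; rewrite hornerM.
rewrite [X in nm X](_ : _ = f z * (g z - q.[z]) + (f z - p.[z]) * q.[z]); last by ring.
rewrite (le_trans (nmD _ _))// (splitr e) !nmM lerD//.
  rewrite (@le_trans _ _ (M * (e / 2 / M)))//.
    by rewrite ler_pM ?nm_ge0 ?fM ?qg.
  by rewrite mulrC divfK ?gt_eqF.
rewrite (@le_trans _ _ (e / 2 / (1 + majorant q 1) * (1 + majorant q 1)))//.
  rewrite ler_pM ?nm_ge0 ?pf// (le_trans (@nm_horner_le _ q z 1 _)) ?U1//.
  by rewrite lerDr.
by rewrite divfK ?gt_eqF.
Qed.

(** The geometric series of [- f] converges uniformly, with ratio at most [q], and its partial sums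
    are polynomial expressions in [f]. *)
Lemma poly_approximable_neumann U f q : (forall z, U z -> nm z <= 1) ->
  q < 1 -> (forall z, U z -> nm (f z) <= q) ->
  poly_approximable U f -> poly_approximable U (fun z => (1 + f z)^-1).
Proof.
move=> U1 q1 fq fa e e0.
have [[z0 Uz0]|noU] := pselect (exists z, U z); last first.
  by exists 0 => z Uz; exfalso; apply: noU; exists z.
have q0 : 0 <= q by rewrite (le_trans (nm_ge0 (f z0)))// fq.
have q1' : 0 < 1 - q by rewrite subr_gt0.
have Sa n : poly_approximable U (fun z => \sum_(k < n) (- f z) ^+ k).
  elim: n => [|n ih].
    apply: (eq_poly_approximable _ (poly_approximable_horner U 0)) => z _.
    by rewrite horner0 big_ord0.
  have h1 : poly_approximable U (fun z => (-1)%:P.[z] * (f z * \sum_(k < n) (- f z) ^+ k)).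
    apply: poly_approximableM => //; first exact: poly_approximable_horner.
    exact: poly_approximableM.
  have := poly_approximableD (poly_approximable_horner U 1) h1.
  apply: eq_poly_approximable => z _.
  rewrite big_ord_recl/= expr0 -polyC1 !hornerC mulN1r mulr_sumr -sumrN; congr (_ + _).
  by apply: eq_bigr => i _; rewrite exprS mulNr.
have e1 : 0 < e / 2 * (1 - q) by rewrite mulr_gt0 ?divr_gt0.
have [n /(_ n (leqnn n)) qn] := expr_small q0 q1 e1.
have [|p pf] := Sa n (e / 2); first by rewrite divr_gt0.
exists p => z Uz; rewrite (splitr e).
apply: (le_trans (nm_tri (\sum_(k < n) (- f z) ^+ k) _ _)); rewrite lerD ?pf//.
have nf : 1 - q <= nm (1 + f z).
  have := nm_sub_le 1 (- f z); rewrite nm1 nmN opprK => h.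
  by have := fq z Uz; lra.
have fn0 : 1 + f z != 0.
  by rewrite -nm_eq0 gt_eqF// (lt_le_trans _ nf).
have -> : (1 + f z)^-1 - \sum_(k < n) (- f z) ^+ k = (- f z) ^+ n / (1 + f z).
  apply: (mulfI fn0); rewrite mulrBr divff// [RHS]mulrC divfK//.
  have := subrX1 (- f z) n; rewrite -opprB -[X in _ = X * _]opprB opprK.
  by rewrite mulNr => /oppr_inj <-; ring.
rewrite nmM nmX nmN nmV ler_pdivrMr ?(lt_le_trans _ nf)//.
apply: (@le_trans _ _ (q ^+ n)).
  by rewrite lerXn2r ?nnegrE ?nm_ge0 ?fq.
by rewrite (le_trans qn)// ler_wpM2l// ltW// divr_gt0.
Qed.

(** The closed unit disk minus an open sector around the positive axis. The origin is kept, and a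
    point [a > 0] of the axis lies at a distance from this set proportional to [a]. *)
Definition cone c : set R[i] := [set z | nm z <= 1 /\ complex.Re z <= c * nm z].

(** Completing the square, the squared distance is at least [(nm z - a * c) ^+ 2 + a ^+ 2 * (1 - c
    ^+ 2)]. The stated bound is slightly weaker than this, which avoids a square root. *)
Lemma cone_dist c z (a : R) : 0 < c < 1 -> cone c z -> 0 < a ->
  a * (1 - c ^+ 2) <= nm (z - a%:C).
Proof.
move=> /andP[c0 c1] [_ zc] a0.
have n0 := nm_ge0 z.
rewrite -(@ler_pXn2r _ 2) ?nnegrE ?nm_ge0//; last by rewrite mulr_ge0 ?ltW//; nra.
have h : nm (z - a%:C) ^+ 2 = nm z ^+ 2 - 2 * a * complex.Re z + a ^+ 2.
  by rewrite !sqr_nm; case: (z) => x y /=; ring.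
rewrite h.
have h1 : a * complex.Re z <= a * (c * nm z) by rewrite ler_wpM2l// ltW.
have h2 : 0 <= (nm z - a * c) ^+ 2 by exact: sqr_ge0.
have c21 : 0 <= 1 - c ^+ 2 <= 1 by apply/andP; split; nra.
have h3 : (1 - c ^+ 2) * (1 - c ^+ 2) <= 1 - c ^+ 2 by nra.
have h4 : a ^+ 2 * ((1 - c ^+ 2) * (1 - c ^+ 2)) <= a ^+ 2 * (1 - c ^+ 2).
  by rewrite ler_wpM2l ?sqr_ge0.
by nra.
Qed.

(** The pole starts at 2, where the geometric series converges on the unit disk, and moves from [a]
    to [a - t] with [t = a * (s / 2)]. Since [a * s] bounds the distance of [a] to the cone from
    below, [t / (z - a)] has modulus at most 1/2 and the Neumann series applies. The steps are
    proportional to [a], so the pole approaches 0 geometrically. *)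
Lemma cone_pole_push c n : 0 < c < 1 -> poly_approximable (cone c)
  (fun z => (z - (2 * (1 - (1 - c ^+ 2) / 2) ^+ n)%:C)^-1).
Proof.
move=> c01; have /andP[c0 c1] := c01.
have U1 z : cone c z -> nm z <= 1 by case.
set s := 1 - c ^+ 2.
have s0 : 0 < s by rewrite /s; nra.
have s1 : s < 1 by rewrite /s; nra.
have dist z a : cone c z -> 0 < a -> a * s <= nm (z - a%:C) by exact: cone_dist.
elim: n => [|n ih].
  have half z : cone c z -> nm ((- 2^-1)%:P * 'X : {poly R[i]}).[z] <= 2^-1.
    case=> z1 _; rewrite hornerM hornerC hornerX nmM nmN nmV.
    rewrite (_ : 2%R = 2%:C :> R[i]); last by rewrite rmorphMn.
    by rewrite nmR ger0_norm// -[leRHS]mulr1 ler_wpM2l ?invr_ge0.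
  have := poly_approximableM U1 (poly_approximable_horner _ (- 2^-1)%:P)
    (@poly_approximable_neumann (cone c) _ 2^-1 U1 _ half
      (poly_approximable_horner _ _)).
  have -> : (2^-1 : R) < 1 by lra.
  move=> /(_ isT); apply: eq_poly_approximable => z Uz.
  have : z - 2 != 0.
    rewrite (_ : 2%R = 2%:C :> R[i]); last by rewrite rmorphMn.
    rewrite -nm_eq0 gt_eqF// (lt_le_trans _ (dist z 2 Uz _))// mulr_gt0//.
  rewrite expr0 mulr1 (_ : 2%:C = 2%R :> R[i]); last by rewrite rmorphMn.
  move=> z2.
  rewrite hornerM !hornerC hornerX.
  have z2' : 1 + - 2^-1 * z = - 2^-1 * (z - 2) by field.
  by rewrite z2' invfM mulrA divff ?mul1r// oppr_eq0 invr_eq0 pnatr_eq0.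
set a := 2 * (1 - s / 2) ^+ n in ih *.
have a0 : 0 < a by rewrite mulr_gt0// exprn_gt0//; lra.
have -> : 2 * (1 - s / 2) ^+ n.+1 = a - a * (s / 2) by rewrite /a exprS; ring.
set t := a * (s / 2).
have t0 : 0 < t by rewrite /t; nra.
have half z : cone c z -> nm (t%:C%:P.[z] * (z - a%:C)^-1) <= 2^-1.
  move=> Uz; rewrite hornerC nmM nmR nmV gtr0_norm// ler_pdivrMr.
    by have := dist z a Uz a0; rewrite /t; lra.
  by rewrite (lt_le_trans _ (dist z a Uz a0))// mulr_gt0.
have h1 : (2^-1 : R) < 1 by lra.
have := poly_approximableM U1 ih (poly_approximable_neumann U1 h1 half
      (poly_approximableM U1 (poly_approximable_horner _ _) ih)).
apply: eq_poly_approximable => z Uz; rewrite hornerC.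
have za : z - a%:C != 0.
  by rewrite -nm_eq0 gt_eqF// (lt_le_trans _ (dist z a Uz _))// mulr_gt0.
have e1 : z - (a - t)%:C = (z - a%:C) * (1 + t%:C / (z - a%:C)).
  by rewrite mulrDr mulr1 mulrCA divff// mulr1 rmorphB/=; ring.
by rewrite e1 invfM.
Qed.

(* The function [- d / (z - d)], with a pole at a small [d > 0], equals [1] at
   [0], is small on the unit circle, and is bounded on the cone independently
   of [d]. *)
Lemma cone_switch c : 0 < c < 1 -> exists2 K, 0 < K &
  forall e, 0 < e -> exists g : {poly R[i]}, forall z, cone c z ->
    nm (z * g.[z]) <= K /\ (nm z = 1 -> nm (z * g.[z] - 1) <= e).
Proof.
move=> c01; have /andP[c0 c1] := c01.
set s := 1 - c ^+ 2.
have s0 : 0 < s by rewrite /s; nra.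
have s1 : s < 1 by rewrite /s; nra.
exists (2 + s^-1); first by rewrite addr_gt0// invr_gt0.
(* Three errors of size [e'] add up to at most [e]; the minimum with 1 keeps the bound on the cone
   independent of [e]. *)
move=> e e0; set e' := Num.min e 1 / 3.
have m0 : 0 < Num.min e 1 by rewrite lt_min e0 ltr01.
have [me m1] : Num.min e 1 <= e /\ Num.min e 1 <= 1.
  by split; rewrite ge_min lexx ?orbT.
have e'0 : 0 < e' by rewrite divr_gt0.
have q0 : 0 <= 1 - s / 2 by lra.
have q1 : 1 - s / 2 < 1 by lra.
have [|n /(_ n (leqnn n)) hn] := @expr_small _ (e' / 4) q0 q1.
  by rewrite divr_gt0.
set d := 2 * (1 - s / 2) ^+ n.
have d0 : 0 < d by rewrite mulr_gt0// exprn_gt0//; lra.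
have de : d <= e' / 2 by rewrite /d; lra.
have dist z : cone c z -> d * s <= nm (z - d%:C).
  by move=> Uz; exact: cone_dist.
have zd z : cone c z -> z - d%:C != 0.
  by move=> Uz; rewrite -nm_eq0 gt_eqF// (lt_le_trans _ (dist z Uz))// mulr_gt0.
have U1 z : cone c z -> nm z <= 1 by case.
have [p pf] := poly_approximableM U1 (poly_approximable_horner _ (- d%:C)%:P)
  (cone_pole_push n c01) e'0.
have {}pf z : cone c z -> nm (- d%:C / (z - d%:C) - p.[z]) <= e'.
  by move=> /pf; rewrite hornerC.
have U0 : cone c 0 by split; rewrite nm0//= mulr0.
have H0 : nm (1 - p.[0]) <= e'.
  have := pf 0 U0; rewrite sub0r divff// oppr_eq0.
  by have := zd 0 U0; rewrite sub0r oppr_eq0.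
(* Since [p] approximates [- d / (z - d)], the difference [p.[0] - p] approximates [z / (z - d)]. It
   vanishes at the origin, so a factor [z] splits off. *)
have : root (p.[0]%:P - p) 0 by rewrite rootE hornerD hornerN hornerC subrr.
move=> /factor_theorem[g gE]; exists g => z Uz.
have {}gE : z * g.[z] = p.[0] - p.[z].
  have := congr1 (fun u => u.[z]) gE.
  by rewrite hornerD hornerN hornerC hornerM subr0 hornerX mulrC => <-.
rewrite gE; have hz := pf z Uz; have Hd := dist z Uz.
have nd : nm (- d%:C / (z - d%:C)) = d / nm (z - d%:C).
  by rewrite nmM nmN nmV nmR gtr0_norm.
have nzd : 0 < nm (z - d%:C) by rewrite (lt_le_trans _ Hd)// mulr_gt0.
have e'1 : e' <= 1 / 3 by rewrite /e'; lra.
split.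
  have hp0 : nm p.[0] <= 1 + e'.
    rewrite -[p.[0]](subrK 1) (le_trans (nmD _ _))// nm1 addrC lerD2l.
    by rewrite nmBC.
  have hpz : nm p.[z] <= s^-1 + e'.
    rewrite -[p.[z]](subrK (- d%:C / (z - d%:C))) (le_trans (nmD _ _))//.
    rewrite nmBC addrC lerD// nd ler_pdivrMr// mulrC ler_pdivlMr//.
  by rewrite (le_trans (nmB _ _))//; lra.
move=> z1.
have h1 : 1 / 2 <= nm (z - d%:C).
  by have := nm_sub_le z d%:C; rewrite z1 nmR gtr0_norm//; lra.
have h2 : nm (- d%:C / (z - d%:C)) <= e'.
  rewrite nd ler_pdivrMr// (@le_trans _ _ (e' * (1 / 2)))//; first lra.
  by rewrite ler_wpM2l// ltW.
have -> : p.[0] - p.[z] - 1 = (p.[0] - 1) + (- d%:C / (z - d%:C) - p.[z])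
   - (- d%:C / (z - d%:C)) by ring.
rewrite (le_trans (nmB _ _))//.
have h3 := nmD (p.[0] - 1) (- d%:C / (z - d%:C) - p.[z]).
by have h4 := nmBC p.[0] 1; rewrite /e' in H0 hz h2 *; lra.
Qed.

End PolynomialApproximation.

(** * Small sets and the unit circle *)

Section SmallSets.
Context {R : realType}.
Local Notation mu := (@lebesgue_measure R).
Implicit Types (A B : set R) (a b e : R).

(** An outer measure bound: exceptional sets can be estimated without proving them measurable. *)
Definition small A e := exists B, [/\ measurable B, A `<=` B & (mu B <= e%:E)%E].

Lemma smallS A B a b : A `<=` B -> a <= b -> small B a -> small A b.
Proof.
move=> AB ab [C [mC BC Ca]]; exists C; split => //.
  exact: subset_trans BC.
by rewrite (le_trans Ca)// lee_fin.
Qed.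

Lemma smallU A B a b : small A a -> small B b -> small (A `|` B) (a + b).
Proof.
move=> [C [mC AC Ca]] [D [mD BD Db]]; exists (C `|` D); split.
- exact: measurableU.
- exact: setUSS.
- by rewrite EFinD (le_trans (measureU2 _ _ _))// leeD.
Qed.

Lemma small_negligible A : mu.-negligible A -> small A 0.
Proof. by move=> [N [mN N0 AN]]; exists N; split => //; rewrite N0. Qed.

Lemma small_itv (x y : R) : x <= y -> small `]x, y[%classic (y - x).
Proof.
move=> xy; exists `]x, y[%classic; split => //.
rewrite lebesgue_measure_itv/= lte_fin; case: ifPn => // _.
by rewrite lee_fin subr_ge0.
Qed.

Lemma small_bigsetU n (F : nat -> set R) a : (forall i, small (F i) a) ->
  small (\big[setU/set0]_(i < n) F i) (a *+ n).
Proof.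
move=> Fa; elim: n => [|n ih].
  by rewrite big_ord0; apply: small_negligible; exact: negligible_set0.
by rewrite big_ord_recr mulrSr; exact: smallU.
Qed.

(** Continuity from above of Lebesgue measure, available because [F 0] lies in a bounded
    interval. *)
Lemma small_nonincreasing (F : nat -> set R) e : (forall n, measurable (F n)) ->
  F 0%N `<=` `[0, 2 * pi]%classic -> (forall n, F n.+1 `<=` F n) ->
  mu.-negligible (\bigcap_n F n) -> 0 < e -> exists n, small (F n) e.
Proof.
move=> mF F0 dF nF e0.
have niF : nonincreasing_seq F.
  by apply/nonincreasing_seqP => n; apply/subsetPset; exact: dF.
have mcap : measurable (\bigcap_n F n) by exact: bigcapT_measurable.
have F0y : (mu (F 0%N) < +oo)%E.
  apply: (@le_lt_trans _ _ (mu `[0, 2 * pi]%classic)).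
    by rewrite le_measure// ?inE//; exact: mF.
  by rewrite lebesgue_measure_itv/=; case: ifP => _; rewrite ?ltry// -EFinB ltry.
have : mu \o F @ \oo --> 0%E.
  have <- : mu (\bigcap_n F n) = 0%E.
    exact: (@measure_negligible _ (measurableTypeR R)).
  exact: (@nonincreasing_cvg_mu _ (measurableTypeR R)).
move=> /fine_cvgP[fF].
move=> /cvgrPdist_le/(_ e e0) H.
near \oo => n; exists n; exists (F n); split => //.
have h1 : mu (F n) \is a fin_num by near: n.
rewrite -(fineK h1) lee_fin.
have : `|0 - fine (mu (F n))| <= e by near: n.
by rewrite sub0r normrN; apply: le_trans; exact: ler_norm.
Unshelve. all: by end_near. Qed.

End SmallSets.

Section UnitCircle.
Context {R : realType}.
Implicit Types s t : R.

Definition cis t : R[i] := cos t +i* sin t.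

Lemma nm_cis t : nm (cis t) = 1.
Proof. by rewrite /nm/= cos2Dsin2 sqrtr1. Qed.

Lemma cisD s t : cis (s + t) = cis s * cis t.
Proof. by rewrite /cis cosD sinD; simpc; congr (_ +i* _); ring. Qed.

Lemma cis0 : cis 0 = 1.
Proof. by rewrite /cis cos0 sin0. Qed.

Lemma cis_neq0 t : cis t != 0.
Proof. by rewrite -nm_eq0 nm_cis oner_eq0. Qed.

Lemma cisN t : cis (- t) = (cis t)^-1.
Proof. by apply: (mulfI (cis_neq0 t)); rewrite -cisD subrr cis0 divff ?cis_neq0. Qed.

Lemma cisX t n : cis t ^+ n = cis (n%:R * t).
Proof.
elim: n => [|n ih]; first by rewrite expr0 mul0r cis0.
by rewrite exprS ih -cisD; congr cis; rewrite -natr1; ring.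
Qed.

Lemma cos_period k t : cos (t - (2 * pi) * k%:R) = cos t.
Proof.
rewrite -(periodicn (@cosD2pi R) k (t - 2 * pi * k%:R)) -[pi *+ 2]mulr_natl.
by rewrite -[2 * pi *+ k]mulr_natr subrK.
Qed.

Lemma cos_le_cos (x y : R) : 0 <= x -> x <= pi -> x <= y -> y <= 2 * pi - x ->
  cos y <= cos x.
Proof.
move=> x0 xpi xy yx.
have key (z : R) : x <= z -> z <= pi -> cos z <= cos x.
  move=> xz zpi; have [->//|xz'] := eqVneq x z.
  apply: ltW; rewrite ltr_cos ?lt_neqAle ?xz'// ?in_itv/=; apply/andP; split => //.
  by rewrite (le_trans x0).
have [ypi|piy] := leP y pi; first exact: key.
rewrite -cosN -(@cos_period 0) mulr0 subr0 -(cosD2pi (- y)) addrC -mulr_natl.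
by apply: key; lra.
Qed.

(** With [c = cos k], the inequality forces [m * t] to be within [k] of a multiple of [2 * pi]. This
    leaves [m + 1] intervals of length [2 * k / m], one around each multiple from 0 to [m], of total
    length at most [4 * k], whatever [m] is. *)
Lemma small_cos_gt (e : R) : 0 < e -> exists2 c, 0 < c < 1 &
  forall m, (0 < m)%N -> small [set t | 0 <= t < 2 * pi /\ c < cos (m%:R * t)] e.
Proof.
move=> e0; set k := Num.min (e / 4) 1.
have k0 : 0 < k by rewrite lt_min ltr01 andbT divr_gt0.
have k1 : k <= 1 by rewrite /k ge_min lexx orbT.
have ke : k <= e / 4 by rewrite /k ge_min lexx.
have pi2 := @pi_ge2 R; have pi0 := @pi_gt0 R.
have pih := @pihalf_ge1 R.
exists (cos k).
  apply/andP; split.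
    by apply: (@lt_le_trans _ _ (cos 1)); [exact: cos1_gt0|apply: cos_le_cos; lra].
  by rewrite -[ltRHS]cos0 ltr_cos// in_itv/=; apply/andP; split; lra.
move=> m m0.
pose F (j : nat) := `](2 * pi * j%:R - k) / m%:R, (2 * pi * j%:R + k) / m%:R[%classic : set R.
have m0' : 0 < m%:R :> R by rewrite ltr0n.
have Fs j : small (F j) (2 * k / m%:R).
  apply: smallS (@small_itv _ ((2 * pi * j%:R - k) / m%:R) ((2 * pi * j%:R + k) / m%:R) _) => //.
    by rewrite -mulrBl ler_pM2r ?invr_gt0//; lra.
  by rewrite ler_pM2r ?invr_gt0//; lra.
apply: smallS (small_bigsetU m.+1 Fs).
  move=> t /= [/andP[t0 t2pi] ct].
  have x0 : 0 <= m%:R * t / (2 * pi) by rewrite divr_ge0 ?mulr_ge0//; lra.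
  (* [j] counts the full turns made by [m * t]; the nearest multiple of [2 * pi] is the one of index
     [j] or [j + 1]. *)
  have /andP[] := truncn_itv x0; set j := Num.truncn _ => jx xj.
  rewrite ler_pdivlMr ?mulr_gt0// in jx.
  rewrite ltr_pdivrMr ?mulr_gt0// -natr1 in xj.
  have jm : (j < m)%N.
    rewrite -(ltr_nat R) -(@ltr_pM2r _ (2 * pi)) ?mulr_gt0//.
    by rewrite (le_lt_trans jx)// ltr_pM2l.
  rewrite -bigcup_mkord.
  have FE i : `|m%:R * t - 2 * pi * i%:R| < k -> F i t.
    rewrite ltr_norml => /andP[h1 h2]; rewrite /F /= in_itv/=.
    by rewrite ltr_pdivrMr// ltr_pdivlMr//; apply/andP; split; lra.
  set a := m%:R * t - 2 * pi * j%:R.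
  have ca : cos (m%:R * t) = cos a by rewrite /a cos_period.
  have [ak|ka] := ltP a k.
    exists j => //=; first by rewrite ltnS ltnW.
    by apply: FE; rewrite ger0_norm; rewrite /a in ak *; lra.
  have [ak|ka'] := ltP (2 * pi - a) k.
    exists j.+1 => //=; apply: FE.
    by rewrite -natr1 ltr0_norm; rewrite /a in ak xj *; lra.
  have : cos a <= cos k by apply: cos_le_cos; lra.
  by rewrite leNgt -ca ct.
rewrite -[leLHS]mulr_natr -[m.+1%:R]natr1 mulrDr mulr1 divfK ?gt_eqF//.
have : 2 * k / m%:R <= 2 * k.
  by rewrite ler_pdivrMr// ler_peMr ?ler1n// mulr_ge0// ltW.
by lra.
Qed.

End UnitCircle.

(** * Approximation in measure by analytic polynomials *)

Section ApproximationInMeasure.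
Context {R : realType}.
Implicit Types (f g : R -> R[i]) (e : R).

(* [f] is a limit in measure, on the circle, of polynomials in [cis t] *)
Definition approximable f := forall e, 0 < e -> exists p : {poly R[i]},
  small [set t | 0 <= t < 2 * pi /\ e < nm (f t - p.[cis t])] e.

Lemma approximable_lim f :
  (forall e, 0 < e -> exists2 g, approximable g &
     small [set t | 0 <= t < 2 * pi /\ e < nm (f t - g t)] e) ->
  approximable f.
Proof.
move=> fg e e0; have e2 : 0 < e / 2 by rewrite divr_gt0.
have [g ga gf] := fg _ e2; have [p pg] := ga _ e2.
exists p; apply: smallS (smallU gf pg); last by rewrite -splitr.
move=> t /= [t2pi et].
have [h|h] := ltP (e / 2) (nm (f t - g t)); [by left|right; split => //].
rewrite ltNge; apply/negP => h'; move: et; apply/negP; rewrite -leNgt.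
by rewrite (le_trans (nm_tri (g t) _ _))// (splitr e) lerD.
Qed.

Lemma eq_approximable f g : (forall t, 0 <= t < 2 * pi -> f t = g t) ->
  approximable f -> approximable g.
Proof.
move=> fg fa; apply: approximable_lim => e e0; exists f => //.
apply: (@smallS _ _ set0 0); [|exact: ltW|exact/small_negligible/negligible_set0].
by move=> t /= [t2pi]; rewrite fg// subrr nm0 => /(lt_trans e0); rewrite ltxx.
Qed.

Lemma approximable_horner (p : {poly R[i]}) : approximable (fun t => p.[cis t]).
Proof.
move=> e e0; exists p.
apply: (@smallS _ _ set0 0); [|exact: ltW|exact/small_negligible/negligible_set0].
by move=> t /= [t2pi]; rewrite subrr nm0 => /(lt_trans e0); rewrite ltxx.
Qed.

Lemma approximable_cst (c : R[i]) : approximable (fun=> c).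
Proof.
have := approximable_horner c%:P; apply: eq_approximable => t _.
by rewrite hornerC.
Qed.

Lemma approximableD f g : approximable f -> approximable g ->
  approximable (fun t => f t + g t).
Proof.
move=> fa ga e e0; have e2 : 0 < e / 2 by rewrite divr_gt0.
have [p pf] := fa _ e2; have [q qg] := ga _ e2.
exists (p + q); apply: smallS (smallU pf qg); last by rewrite -splitr.
move=> t /= [t2pi et].
have [h|h] := ltP (e / 2) (nm (f t - p.[cis t])); [by left|right; split => //].
rewrite ltNge; apply/negP => h'; move: et; apply/negP; rewrite -leNgt.
rewrite hornerD [X in nm X](_ : _ = (f t - p.[cis t]) + (g t - q.[cis t])); last by ring.
by rewrite (le_trans (nmD _ _))// (splitr e) lerD.
Qed.

Lemma nm_horner_cis (p : {poly R[i]}) t : nm p.[cis t] <= majorant p 1.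
Proof. by apply: nm_horner_le; rewrite nm_cis. Qed.

(** The factors may be unbounded. A preliminary approximation [q0] bounds [g] off a small set, which
    fixes the tolerance for [p]; the majorant of [p] then fixes the tolerance for the final [q]. *)
Lemma approximableM f g : approximable f -> approximable g ->
  approximable (fun t => f t * g t).
Proof.
move=> fa ga e e0; have e4 : 0 < e / 4 by rewrite divr_gt0.
have [q0 hq0] := ga _ e4; set M := majorant q0 1 + e / 4.
have M0 : 0 < M by rewrite ltr_wpDl// majorant_ge0.
pose e1 := Num.min (e / 4) (e / 2 / M).
have e10 : 0 < e1 by rewrite lt_min e4 !divr_gt0.
have [e1e e1M] : e1 <= e / 4 /\ e1 <= e / 2 / M.
  by split; rewrite ge_min lexx ?orbT.
have [p hp] := fa _ e10; set N := majorant p 1 + 1.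
have N0 : 0 < N by rewrite ltr_wpDl// majorant_ge0.
pose e2 := Num.min (e / 4) (e / 2 / N).
have e20 : 0 < e2 by rewrite lt_min e4 !divr_gt0.
have [e2e e2N] : e2 <= e / 4 /\ e2 <= e / 2 / N.
  by split; rewrite ge_min lexx ?orbT.
have [q hq] := ga _ e20.
exists (p * q); apply: smallS (smallU hq0 (smallU hp hq)); last by lra.
move=> t /= [t2pi et].
have [h0|h0] := ltP (e / 4) (nm (g t - q0.[cis t])); [by left|right].
have [h1|h1] := ltP e1 (nm (f t - p.[cis t])); [by left|right; split => //].
rewrite ltNge; apply/negP => h2; move: et; apply/negP; rewrite -leNgt hornerM.
rewrite [X in nm X](_ : _ = (f t - p.[cis t]) * g t + p.[cis t] * (g t - q.[cis t])); last by ring.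
rewrite (le_trans (nmD _ _))// (splitr e) !nmM lerD//.
  rewrite (@le_trans _ _ (e / 2 / M * M))//; last by rewrite divfK ?gt_eqF.
  rewrite ler_pM ?nm_ge0 ?(le_trans h1)//.
  rewrite -[g t](subrK q0.[cis t]) (le_trans (nmD _ _))// addrC lerD//.
  exact: nm_horner_cis.
rewrite (@le_trans _ _ (N * (e / 2 / N)))//; last by rewrite mulrC divfK ?gt_eqF.
rewrite ler_pM ?nm_ge0 ?(le_trans h2)//.
by rewrite (le_trans (nm_horner_cis _ _))// lerDl.
Qed.

Lemma approximableX f n : approximable f -> approximable (fun t => f t ^+ n).
Proof.
move=> fa; elim: n => [|n ih]; first exact: approximable_cst.
by have := approximableM fa ih; apply: eq_approximable => t _; rewrite exprS.
Qed.

Lemma approximable_cis : approximable cis.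
Proof.
by have := approximable_horner 'X; apply: eq_approximable => t _; rewrite hornerX.
Qed.

Lemma cone_cis (c rho t : R) : 0 <= rho <= 1 -> cos t <= c -> cone c (rho%:C * cis t).
Proof.
move=> /andP[r0 r1] tc; split; rewrite nmM nmR nm_cis mulr1 ger0_norm//.
by rewrite /cis/= mul0r subr0 mulrC ler_wpM2r.
Qed.

(** The conjugate of [z] on the circle is its inverse, and [cone_switch] makes [z * g.[z]] close to
    1 off a short arc, so [g] is close to the inverse there. Uniform approximation on the whole
    circle is impossible; in measure it works. *)
Lemma approximable_cisN : approximable (fun t => cis (- t)).
Proof.
move=> e e0; have [c c01 /(_ 1%N isT) sc] := small_cos_gt e0.
have [K K0 /(_ _ e0)[g gK]] := cone_switch c01.
exists g; apply: smallS sc => // t /= [t2pi et]; split => //; rewrite mul1r.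
rewrite ltNge; apply/negP => h; move: et; apply/negP; rewrite -leNgt.
have Ut : cone c (cis t).
  by have := @cone_cis c 1 t; rewrite mul1r; apply => //; rewrite lexx ler01.
have [_ /(_ (nm_cis t)) H] := gK _ Ut.
rewrite -[leLHS]mul1r -{1}(nm_cis t) -nmM mulrBr cisN divff ?cis_neq0//.
by rewrite nmBC.
Qed.

Lemma approximable_cos : approximable (fun t => (cos t)%:C).
Proof.
have := approximableM (approximable_cst 2^-1)
  (approximableD approximable_cis approximable_cisN).
apply: eq_approximable => t _; apply: (mulfI (_ : 2 != 0 :> R[i])).
  by rewrite pnatr_eq0.
rewrite mulrA divff ?pnatr_eq0// mul1r /cis cosN sinN mulr2n mulrDl mul1r.
by apply/eqP; rewrite eq_complex/=; apply/andP; split; apply/eqP; ring.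
Qed.

Lemma approximable_sin : approximable (fun t => (sin t)%:C).
Proof.
have := approximableM (approximable_cst (- 'i))
  (approximableD approximable_cis (approximableM (approximable_cst (-1)) approximable_cos)).
apply: eq_approximable => t _; rewrite /cis.
by apply/eqP; rewrite eq_complex/=; apply/andP; split; apply/eqP; ring.
Qed.

(* As [n] grows this tends to [1] for [0 <= y < 1/2] and to [0] for [1/2 < y <= 1]. *)
Definition step_poly n (y : R) := (1 - y ^+ n) ^+ (2 ^ n).

Lemma bernoulli_ge (u : R) n : 0 <= u -> 1 + n%:R * u <= (1 + u) ^+ n.
Proof.
move=> u0; elim: n => [|n ih]; first by rewrite mul0r addr0 expr0.
rewrite exprS -natr1.
have : (1 + u) * (1 + n%:R * u) <= (1 + u) * (1 + u) ^+ n.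
  by rewrite ler_wpM2l// addr_ge0.
have : 0 <= n%:R * (u * u) by rewrite !mulr_ge0.
by lra.
Qed.

Lemma bernoulli_le (u : R) n : 0 <= u <= 1 -> 1 - n%:R * u <= (1 - u) ^+ n.
Proof.
move=> /andP[u0 u1]; elim: n => [|n ih]; first by rewrite mul0r subr0 expr0.
rewrite exprS -natr1.
have : (1 - u) * (1 - n%:R * u) <= (1 - u) * (1 - u) ^+ n.
  by rewrite ler_wpM2l// subr_ge0.
have : 0 <= n%:R * (u * u) by rewrite !mulr_ge0.
by lra.
Qed.

Lemma step_poly_itv n y : 0 <= y <= 1 -> 0 <= step_poly n y <= 1.
Proof.
move=> /andP[y0 y1]; have h : 0 <= 1 - y ^+ n <= 1.
  by rewrite subr_ge0 exprn_ile1//= gerBl exprn_ge0.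
by move/andP: h => [h0 h1]; rewrite exprn_ge0// exprn_ile1.
Qed.

(** Bernoulli's inequality with [u = y ^+ n] and exponent [2 ^ n]. *)
Lemma step_poly_left n (y : R) : 0 <= y <= 1 -> 1 - step_poly n y <= (2 * y) ^+ n.
Proof.
move=> /andP[y0 y1]; have u01 : 0 <= y ^+ n <= 1 by rewrite exprn_ge0//= exprn_ile1.
by have := bernoulli_le (2 ^ n) u01; rewrite /step_poly natrX exprMn; lra.
Qed.

(** The product of [(1 - u) ^+ N] and [(1 + u) ^+ N] is at most 1, and Bernoulli's inequality bounds
    the second factor below by [N * u], here [(2 * y) ^+ n]. *)
Lemma step_poly_right n (y : R) : 0 < y <= 1 -> step_poly n y <= (2 * y)^-1 ^+ n.
Proof.
move=> /andP[y0 y1].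
have /andP[u0 u1] : 0 <= y ^+ n <= 1 by rewrite exprn_ge0 ?exprn_ile1// ltW.
rewrite exprVn -[leRHS]mul1r ler_pdivlMr; last by rewrite exprn_gt0// mulr_gt0.
have h1 := bernoulli_ge (2 ^ n) u0.
have h2 : step_poly n y * (1 + y ^+ n) ^+ (2 ^ n) <= 1.
  rewrite -exprMn (_ : _ * _ = 1 - (y ^+ n) ^+ 2); last by ring.
  by rewrite exprn_ile1// ?gerBl ?sqr_ge0// subr_ge0 exprn_ile1.
apply: le_trans h2; rewrite ler_wpM2l//.
  by have /(step_poly_itv n)/andP[] : 0 <= y <= 1 by rewrite y1 ltW.
by rewrite (le_trans _ h1)// exprMn natrX lerDr.
Qed.

End ApproximationInMeasure.

(** * From trigonometric polynomials to all measurable functions *)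

Section MeasurableApproximation.
Context {R : realType}.
Local Notation mu := (@lebesgue_measure R).
Implicit Types (f g : R -> R[i]) (e : R) (A B : set R).

Lemma approximable_ae f g :
  mu.-negligible [set t | 0 <= t < 2 * pi /\ f t <> g t] ->
  approximable f -> approximable g.
Proof.
move=> fg fa; apply: approximable_lim => e e0; exists f => //.
apply: smallS (small_negligible fg); last exact: ltW.
move=> t /= [t2pi]; rewrite ltNge => h; split => //.
by move=> ftgt; move: h; rewrite ftgt subrr nm0 ltW.
Qed.

Lemma negligible_set1 (a : R) : mu.-negligible [set a].
Proof.
apply/(@negligibleP _ (measurableTypeR R)); first exact: measurable_set1.
exact: lebesgue_measure_set1.
Qed.

Definition ind A (t : R) : R[i] := (t \in A)%:R.

(** The affine change of variable maps [[-2, 2]] onto [[0, 1]], reversing the order and sending 0 to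
    the threshold 1/2 of the step polynomials. *)
Lemma approximable_step (x : R -> R) n : approximable (fun t => (x t)%:C) ->
  approximable (fun t => (step_poly n ((1 - x t / 2) / 2))%:C).
Proof.
move=> xa.
have ya : approximable (fun t => ((1 - x t / 2) / 2)%:C).
  have := approximableD (approximable_cst 2^-1)
    (approximableM (approximable_cst (- (4^-1))) xa).
  apply: eq_approximable => t _.
  have -> : (1 - x t / 2) / 2 = 2^-1 - 4^-1 * x t by field.
  by rewrite rmorphB/= rmorphM/= !fmorphV/= !rmorphMn/= !rmorph1 mulNr.
have := approximableX (2 ^ n)%N (approximableD (approximable_cst 1)
    (approximableM (approximable_cst (-1)) (approximableX n ya))).
apply: eq_approximable => t _.
by rewrite /step_poly rmorphXn/= rmorphB/= rmorphXn/= rmorph1 mulN1r.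
Qed.

(** By the last hypothesis [x] is rarely close to 0; where [x] stays away from 0, the step
    polynomials of [x] converge uniformly to the indicator, at a geometric rate. *)
Lemma approximable_gt0 (x : R -> R) : approximable (fun t => (x t)%:C) ->
  (forall t, `|x t| <= 2) ->
  (forall e, 0 < e -> exists2 h : R, 0 < h &
    small [set t | 0 <= t < 2 * pi /\ `|x t| <= h] e) ->
  approximable (ind [set t | 0 < x t]).
Proof.
move=> xa x2 xs; apply: approximable_lim => e e0.
have [h h0 hs] := xs _ e0.
have h2 : 0 < h / 2 by rewrite divr_gt0.
set h' := Num.min (h / 2) 1.
have h'0 : 0 < h' by rewrite lt_min h2 ltr01.
have [h'h h'1] : h' <= h / 2 /\ h' <= 1 by split; rewrite ge_min lexx ?orbT.
have q0 : 0 <= 1 - h' by lra.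
have q1 : 1 - h' < 1 by lra.
have p0 : 0 <= (1 + h')^-1 by rewrite invr_ge0; lra.
have p1 : (1 + h')^-1 < 1 by rewrite invf_lt1; lra.
have [n1 hn1] := expr_small q0 q1 e0.
have [n2 hn2] := expr_small p0 p1 e0.
set n := maxn n1 n2.
exists (fun t => (step_poly n ((1 - x t / 2) / 2))%:C); first exact: approximable_step.
apply: smallS hs => // t /= [t2pi et]; split => //.
rewrite leNgt; apply/negP => hx; move: et; apply/negP; rewrite -leNgt.
have := x2 t; rewrite ler_norml => /andP[xm xM].
set y := (1 - x t / 2) / 2.
have y01 : 0 <= y <= 1 by rewrite /y; apply/andP; split; lra.
have /andP[s0 s1] := step_poly_itv n y01.
rewrite /ind; case: (boolP (t \in _)) => [|/negP]; rewrite inE => xt.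
  rewrite -[X in nm (X - _)]/((1 : R)%:C).
  rewrite -rmorphB/= nmR ger0_norm ?subr_ge0//.
  rewrite (le_trans (step_poly_left n y01))// (le_trans _ (hn1 n (leq_maxl _ _)))//.
  rewrite gtr0_norm// in hx.
  by rewrite lerXn2r// ?nnegrE /y; lra.
move/negP: xt; rewrite -leNgt => xt; rewrite sub0r nmN nmR ger0_norm//.
rewrite ler0_norm// in hx.
have y0 : 0 < y <= 1 by rewrite /y; apply/andP; split; lra.
rewrite (le_trans (step_poly_right n y0))// (le_trans _ (hn2 n (leq_maxr _ _)))//.
rewrite lerXn2r ?nnegrE ?invr_ge0 ?lef_pV2 ?posrE /y; lra.
Qed.

(** For [0 < c < 2 * pi] the trigonometric polynomial [x] factors as a product of two sines: on
    [[0, 2 * pi]] it vanishes only at 0, [c] and [2 * pi], is negative before [c] and positive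
    after. Its positivity set is thus the ray, and [approximable_gt0] applies. *)
Lemma approximable_ray (c : R) : approximable (ind `]c, +oo[%classic).
Proof.
have pi0 := @pi_gt0 R.
have mem t : (t \in `]c, +oo[%classic) = (c < t).
  by apply/idP/idP; rewrite inE/= in_itv/= andbT.
have [c0|c0] := leP c 0.
  apply: (approximable_ae _ (approximable_cst 1)).
  apply: (@negligibleS _ (measurableTypeR R) _ _ [set 0]) (negligible_set1 0).
  move=> t /= [/andP[t0 _]]; rewrite /ind mem.
  by case: ltP => // tc _; apply/eqP; rewrite eq_le t0 (le_trans tc).
have [c2pi|c2pi] := leP (2 * pi) c.
  apply: eq_approximable (approximable_cst 0) => t /andP[_ t2pi].
  by rewrite /ind mem ltNge (le_trans (ltW t2pi)).
pose x t := cos (c / 2) - cos (t - c / 2).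
have xE t : x t = - (2 * (sin (t / 2) * sin ((c - t) / 2))).
  rewrite /x (_ : c / 2 = t / 2 + (c - t) / 2); last by field.
  rewrite (_ : t - _ = t / 2 - (c - t) / 2); last by field.
  by rewrite cosD cosB; ring.
have xpos t : c < t -> t < 2 * pi -> 0 < x t.
  move=> ct t2; rewrite xE -mulrN pmulr_rgt0// -mulrN pmulr_rgt0.
    by rewrite -sinN; apply: sin_gt0_pi; apply/andP; split; lra.
  by apply: sin_gt0_pi; apply/andP; split; lra.
have xneg t : 0 < t -> t < c -> x t < 0.
  move=> t0 tc; rewrite xE oppr_lt0 pmulr_rgt0// pmulr_rgt0.
    by apply: sin_gt0_pi; apply/andP; split; lra.
  by apply: sin_gt0_pi; apply/andP; split; lra.
have x0 : x 0 = 0 by rewrite xE mul0r sin0 mul0r mulr0 oppr0.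
have xc : x c = 0 by rewrite xE subrr mul0r sin0 !mulr0 oppr0.
have ccos : continuous (fun t => `|x t|).
  move=> t; apply: (@cvg_norm _ R^o); apply: (@cvgB _ R^o); first exact: cvg_cst.
  apply: continuous_comp; last exact: continuous_cos.
  by apply: (@cvgB _ R^o); [exact: cvg_id|exact: cvg_cst].
have xa : approximable (fun t => (x t)%:C).
  have h := approximableD (approximable_cst (cos (c / 2))%:C)
    (approximableM (approximable_cst (-1))
    (approximableD (approximableM approximable_cos (approximable_cst (cos (c / 2))%:C))
      (approximableM approximable_sin (approximable_cst (sin (c / 2))%:C)))).
  apply: eq_approximable h => t _.
  by rewrite /x cosB rmorphB/= rmorphD/= !rmorphM/= mulN1r.
have xs e : 0 < e -> exists2 h : R, 0 < h &
    small [set t | 0 <= t < 2 * pi /\ `|x t| <= h] e.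
  move=> e0.
  (* These sets decrease to the three zeros of [x], a null set. *)
  pose F n := `[0, 2 * pi]%classic `&` [set t | `|x t| <= n.+1%:R^-1].
  have [n Fn] : exists n, small (F n) e.
    apply: small_nonincreasing => //.
    - move=> n; apply: measurableI => //; apply: closed_measurable.
      apply: (@closed_comp _ _ _ [set y : R | y <= n.+1%:R^-1]); last exact: closed_le.
      by move=> t _; exact: ccos.
    - by move=> t [].
    - move=> n t [h1 h2]; split => //=; rewrite (le_trans h2)//.
      by rewrite lef_pV2 ?posrE// ler_nat.
    apply: (@negligibleS _ (measurableTypeR R) _ _
      ([set 0] `|` [set c] `|` [set 2 * pi])); last first.
      by do 2?[apply: (@negligibleU _ (measurableTypeR R))]; exact: negligible_set1.
    move=> t Ft.
    have xt0 : x t = 0.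
      apply/eqP; rewrite -normr_le0; apply/ler_addgt0Pr => d d0; rewrite add0r.
      near \oo => n; have [_ /= h] := Ft n I; rewrite (le_trans h)//.
      by apply: ltW; near: n; exact: (near_infty_natSinv_lt (PosNum d0)).
    have [+ _] := Ft 0%N I; rewrite /= in_itv/= => /andP[t0 t2].
    have [->|tn0] := eqVneq t 0; first by left; left.
    have [->|tnc] := eqVneq t c; first by left; right.
    have [->|tn2] := eqVneq t (2 * pi); first by right.
    exfalso; have [tc|ct] := ltP t c.
      have /xneg/(_ tc) : 0 < t by rewrite lt_neqAle eq_sym tn0.
      by rewrite xt0 ltxx.
    have /xpos : c < t by rewrite lt_neqAle eq_sym tnc.
    by rewrite xt0 ltxx lt_neqAle tn2 => /(_ t2).
  exists n.+1%:R^-1; first by rewrite invr_gt0.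
  apply: smallS Fn => // t /= [/andP[t0 t2] h]; split => //=.
  by rewrite in_itv/= t0 ltW.
have x2 t : `|x t| <= 2.
  rewrite (le_trans (ler_normB _ _))// -[leRHS]/(1 + 1) lerD// cos_max//.
have := approximable_gt0 xa x2 xs; apply: eq_approximable => t /andP[t0 t2].
rewrite /ind mem; congr (_%:R); congr nat_of_bool.
apply/idP/idP; rewrite inE/=.
  have [//|tc] := ltP c t; have [->|tnc] := eqVneq t c; first by rewrite xc ltxx.
  have [->|tn0] := eqVneq t 0; first by rewrite x0 ltxx.
  have : x t < 0 by apply: xneg; rewrite lt_neqAle ?tnc// eq_sym tn0.
  by move=> /ltW; rewrite leNgt => /negP.
by move=> ct; exact: xpos.
Unshelve. all: by end_near. Qed.

Lemma approximable_ite A f g : approximable (ind A) -> approximable f ->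
  approximable g -> approximable (fun t => if t \in A then f t else g t).
Proof.
move=> Aa fa ga.
have := approximableD (approximableM Aa fa) (approximableM
  (approximableD (approximable_cst 1) (approximableM (approximable_cst (-1)) Aa)) ga).
apply: eq_approximable => t _; rewrite /ind; case: ifP => _.
  by rewrite mulN1r subrr mul1r mul0r addr0.
by rewrite mulr0 addr0 mul0r add0r mul1r.
Qed.

(** The Borel sets with approximable indicator form a sigma-algebra containing the rays. Countable
    unions are reached from finite ones by continuity from above inside [[0, 2 * pi]]. *)
Lemma approximable_measurable A : measurable A -> approximable (ind A).
Proof.
pose GG : set (set R) := [set A | measurable A /\ approximable (ind A)].
suff H : sigma_algebra setT GG.
  suff : @measurable _ (measurableTypeR R) `<=` GG by move=> h /h[].
  rewrite [X in X `<=` _]RGenOInfty.measurableE; apply: smallest_sub => //.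
  move=> _ [c ->]; split; first exact: measurable_itv.
  exact: approximable_ray.
have G0 : GG set0.
  split; first exact: measurable0.
  apply: eq_approximable (approximable_cst 0) => t _; rewrite /ind.
  by rewrite in_set0.
split => //.
  move=> B [mB Ba]; split; first exact: measurableD.
  have := approximable_ite Ba (approximable_cst 0) (approximable_cst 1).
  apply: eq_approximable => t _; rewrite /ind setTD in_setC.
  by case: ifP.
move=> F FG; have mU : measurable (\bigcup_k F k).
  by apply: bigcupT_measurable => k; case: (FG k).
have GU n : GG (\big[setU/set0]_(i < n) F i).
  elim: n => [|n [m1 a1]]; first by rewrite big_ord0.
  rewrite big_ord_recr/=; have [m2 a2] := FG n; split; first exact: measurableU.
  have := approximable_ite a1 (approximable_cst 1) a2.
  apply: eq_approximable => t _; rewrite {2}/ind in_setU /ind.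
  by case: ifP.
split => //; apply: approximable_lim => e e0.
pose T n := `[0, 2 * pi]%classic `&` (\bigcup_k F k `\` \big[setU/set0]_(i < n) F i).
have [n Tn] : exists n, small (T n) e.
  apply: small_nonincreasing => //.
  - move=> n; apply: measurableI => //; apply: measurableD => //.
    by have [] := GU n.
  - by move=> t [].
  - move=> n t [h1 [h2 h3]]; split => //; split => // h4; apply: h3.
    by rewrite big_ord_recr/=; left.
  rewrite (_ : \bigcap_n T n = set0); first exact: negligible_set0.
  rewrite -subset0 => t Tt; have [_ [[k _ Fk] _]] := Tt 0%N I.
  have [_ [_]] := Tt k.+1 I; apply; rewrite big_ord_recr/=; by right.
exists (ind (\big[setU/set0]_(i < n) F i)); first by have [] := GU n.
apply: smallS Tn => // t /= [/andP[t0 t2] et]; split => /=.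
  by rewrite in_itv/= t0 ltW.
have sub : \big[setU/set0]_(i < n) F i `<=` \bigcup_k F k.
  by rewrite -bigcup_mkord => u [k _ Fk]; exists k.
move: et; rewrite /ind.
case/boolP: (t \in \bigcup_k F k) => h1; case/boolP: (t \in \big[setU/set0]_(i < n) F i) => h2.
- by rewrite subrr nm0 => /(lt_trans e0); rewrite ltxx.
- by move=> _; rewrite inE in h1; split => // h3; move/negP: h2; apply; rewrite inE.
- by exfalso; move/negP: h1; apply; rewrite inE; apply: sub; rewrite inE in h2.
- by rewrite subrr nm0 => /(lt_trans e0); rewrite ltxx.
Qed.

(** Off a small set [h] is within [e] of a step function with finitely many values in the grid of
    multiples of [e]. The level sets are only Lebesgue measurable; replacing them by Borel sets
    costs the null set [N]. *)
Lemma approximable_real (h : R -> R) :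
  (forall a e, 0 < e -> lebesgue_measurable [set t | 0 <= t < 2 * pi /\ `|h t - a| < e]) ->
  approximable (fun t => (h t)%:C).
Proof.
move=> hm; apply: approximable_lim => e e0.
(* An enumeration of the grid; the default value 0 merely repeats a grid point. *)
pose c (j : nat) : R := e * (odflt 0%Z (unpickle j))%:~R.
have e' : 0 < e by [].
pose A j := [set t | 0 <= t < 2 * pi /\ `|h t - c j| < e].
have /choice[B BA] : forall j, exists B, measurable B /\
    mu.-negligible ((A j `\` B) `|` (B `\` A j)).
  by move=> j; exact: hm.
have mB j : measurable (B j) by case: (BA j).
pose N := \bigcup_j ((A j `\` B j) `|` (B j `\` A j)).
have nN : mu.-negligible N.
  by apply: (@negligible_bigcup _ (measurableTypeR R)) => j; case: (BA j).
pose T n := `[0, 2 * pi[%classic `\` \big[setU/set0]_(i < n) B i.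
have cover t : 0 <= t < 2 * pi -> exists j, A j t.
  move=> t2pi; exists (pickle (Num.floor (h t / e))); split => //.
  rewrite /c pickleK/=; have /andP[] := floor_itv (h t / e).
  rewrite ler_pdivlMr// ltr_pdivrMr// intrD mulrDl mul1r => h1 h2.
  by rewrite ltr_norml; apply/andP; split; lra.
have [n Tn] : exists n, small (T n) e.
  apply: small_nonincreasing => //.
  - by move=> n; apply: measurableD => //; exact: bigsetU_measurable.
  - by move=> t [] /=; rewrite !in_itv/= => /andP[-> /ltW ->].
  - move=> n t [h1 h2]; split => // h4; apply: h2.
    by rewrite big_ord_recr/=; left.
  apply: (@negligibleS _ (measurableTypeR R)) nN => t Tt; have [+ _] := Tt 0%N I.
  rewrite /= in_itv/= => /cover[j Aj]; exists j => //; left; split => // Bj.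
  by have [_] := Tt j.+1 I; apply; rewrite big_ord_recr/=; right.
(* The sets [B i] may overlap. It suffices that [s] takes at [t] the value attached to some [B k]
   containing [t]; later indices override earlier ones. *)
have [s sa sB] : exists2 s, approximable s & forall t,
    (\big[setU/set0]_(i < n) B i) t -> exists2 k, B k t & s t = (c k)%:C.
  elim: n {Tn} => [|n [s sa sB]].
    exists (fun=> 0); first exact: approximable_cst.
    by move=> t; rewrite big_ord0.
  exists (fun t => if t \in B n then (c n)%:C else s t).
    by apply: approximable_ite => //; [exact: approximable_measurable|exact: approximable_cst].
  move=> t; rewrite big_ord_recr/= => Ut; case: ifPn => [|tB].
    by rewrite inE => Bt; exists n.
  case: Ut => [/sB//|Bt]; exfalso; move/negP: tB; apply; by rewrite inE.
exists s => //; apply: smallS (smallU Tn (small_negligible nN)); last by rewrite addr0.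
move=> t /= [t2pi et].
have [Ut|Ut] := pselect ((\big[setU/set0]_(i < n) B i) t); last first.
  by left; split => //; rewrite /= in_itv.
have [k Bk sk] := sB _ Ut; right; exists k => //; right; split => // -[_ Ak].
by move: et; rewrite sk -rmorphB/= nmR => /(lt_trans Ak); rewrite ltxx.
Qed.

End MeasurableApproximation.

(** * Analytic functions with prescribed radial limits *)

Section StepLemma.
Context {R : realType}.
Implicit Types (P Q p : {poly R[i]}) (e : R).

Lemma majorant_le P (s t : R) : 0 <= s -> s <= t -> majorant P s <= majorant P t.
Proof.
move=> s0 st; apply: ler_sum => i _; rewrite ler_wpM2l ?nm_ge0//.
by rewrite lerXn2r// nnegrE// (le_trans s0).
Qed.

Lemma horner_lipschitz P : exists2 L, 0 < L & forall x y : R[i],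
  nm x <= 1 -> nm y <= 1 -> nm (P.[x] - P.[y]) <= L * nm (x - y).
Proof.
elim/poly_ind: P => [|P c [L L0 ih]].
  by exists 1 => // x y _ _; rewrite !horner0 subrr nm0 mul1r nm_ge0.
have M0 : 0 <= majorant P 1 by exact: majorant_ge0.
exists (L + majorant P 1); first by rewrite ltr_pwDl.
move=> x y x1 y1; rewrite !hornerMXaddC.
rewrite [X in nm X](_ : _ = (P.[x] - P.[y]) * x + P.[y] * (x - y)); last by ring.
rewrite (le_trans (nmD _ _))// !nmM mulrDl lerD//.
  by rewrite -[leRHS]mulr1 ler_pM ?nm_ge0 ?ih.
by rewrite ler_wpM2r ?nm_ge0 ?nm_horner_le.
Qed.

(** The second clause bounds the correction on the whole radius by the error before the correction.
    Once the earlier error is small, this makes the series of corrections converge uniformly on the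
    radius. *)
Definition step_good (psi : R -> R[i]) P Q (C e : R) (t : R) :=
  nm (psi t - (P + Q).[cis t]) <= e /\
  forall rho, 0 <= rho <= 1 ->
    nm Q.[rho%:C * cis t] <= C * (nm (psi t - P.[cis t]) + e).

(** The correction is [p(z) G(z^m)] with [G(z) = z * g.[z]] from [cone_switch]. The constant [C]
    depends on [h] only and is fixed before [P], [r] and [e]; this lets [step_sequence] prepare each
    error for the next constant. *)
Lemma approximation_step (psi : R -> R[i]) (h : R) : approximable psi -> 0 < h ->
  exists2 C, 0 < C & forall P (r e : R), 0 <= r < 1 -> 0 < e -> exists Q,
    majorant Q r <= e /\
    small [set t | 0 <= t < 2 * pi /\ ~ step_good psi P Q C e t] h.
Proof.
move=> psia h0; have h2 : 0 < h / 2 by rewrite divr_gt0.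
have [c c01 sc] := small_cos_gt h2.
have [K K0 gK] := cone_switch c01.
exists (K + 1); first by rewrite addr_gt0.
move=> P r e /andP[r0 r1] e0.
have e2 : 0 < e / 2 by rewrite divr_gt0.
(* The minimum serves accuracy and measure at once; the other [h / 2] of measure goes to the angles
   with [cos (m * t) > c]. *)
have e10 : 0 < Num.min (e / 2) (h / 2) by rewrite lt_min e2.
have [p ps] := approximableD psia (approximable_horner (- P)) e10.
set M := majorant p 1 + 1.
have Mp : 0 <= majorant p 1 by exact: majorant_ge0.
have M0 : 0 < M by rewrite ltr_wpDl.
have eM : 0 < e / 2 / M by rewrite divr_gt0.
have [g gP] := gK _ eM.
have [L L0 pL] := horner_lipschitz p.
(* Beyond [r'], the values of [p] along a radius differ from its end value by at most [e / 2]; up to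
   [r'], the factor [z ^+ m] makes [Q] small. *)
set r' := Num.max r (1 - e / 2 / L).
have eL : 0 < e / 2 / L by rewrite divr_gt0.
have rr' : r <= r' by rewrite le_max lexx.
have r'L : 1 - e / 2 / L <= r' by rewrite le_max lexx orbT.
have r'1 : r' < 1 by rewrite gt_max r1 gtrBl.
have r'0 : 0 <= r' by rewrite (le_trans r0).
set B := majorant p 1 * majorant g 1 + 1.
have Mg : 0 <= majorant g 1 by exact: majorant_ge0.
have B0 : 0 < B by rewrite ltr_wpDl// mulr_ge0.
have eB : 0 < e / B by rewrite divr_gt0.
have [m0 hm] := expr_small r'0 r'1 eB.
set m := maxn m0 1; have m0' : (0 < m)%N by rewrite /m leq_maxr.
have rm : r' ^+ m <= e / B by rewrite hm// leq_maxl.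
pose Q := p * ('X^m * (g \Po 'X^m)).
have Qh z : Q.[z] = p.[z] * (z ^+ m * g.[z ^+ m]).
  by rewrite !hornerM horner_comp !hornerXn.
have Qr' : majorant Q r' <= e.
  rewrite (le_trans (majorantM _ _ _))// majorant_XnM.
  rewrite (@le_trans _ _ (majorant p 1 * (r' ^+ m * majorant g 1)))//.
    rewrite ler_pM ?mulr_ge0 ?majorant_ge0 ?exprn_ge0//.
      by rewrite majorant_le// ltW.
    by rewrite ler_wpM2l ?exprn_ge0// majorant_comp_Xn// ltW.
  rewrite mulrCA (@le_trans _ _ (e / B * (majorant p 1 * majorant g 1)))//.
    by rewrite ler_wpM2r// mulr_ge0.
  rewrite -[leRHS](divfK (lt0r_neq0 B0)) ler_wpM2l ?ltW//.
  by rewrite /B ltrDl.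
exists Q; split; first by rewrite (le_trans _ Qr')// majorant_le.
apply: smallS (smallU ps (sc m m0')); last first.
  by rewrite [leRHS]splitr lerD2r ge_min lexx orbT.
move=> t /= [t2pi ng].
have [hp|hp] := ltP (Num.min (e / 2) (h / 2)) (nm (psi t + (- P).[cis t] - p.[cis t])).
  by left.
right; split => //; rewrite ltNge; apply/negP => cm; apply: ng.
have {}hp : nm (psi t - P.[cis t] - p.[cis t]) <= e / 2.
  by move: hp; rewrite hornerN => /le_trans; apply; rewrite ge_min lexx.
have conem rho : 0 <= rho <= 1 -> cone c ((rho%:C * cis t) ^+ m).
  move=> /andP[rho0 rho1].
  rewrite exprMn cisX -rmorphXn/=; apply: cone_cis => //.
  by rewrite exprn_ge0// exprn_ile1.
have pt : nm p.[cis t] <= nm (psi t - P.[cis t]) + e / 2.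
  rewrite -[p.[cis t]](subrK (psi t - P.[cis t])) addrC (le_trans (nmD _ _))//.
  by rewrite lerD2l nmBC.
split.
  have c1 : 0 <= (1 : R) <= 1 by rewrite ler01 lexx.
  have [_] := gP _ (conem 1 c1); rewrite mul1r => H.
  have {}H : nm (cis t ^+ m * g.[cis t ^+ m] - 1) <= e / 2 / M.
    by apply: H; rewrite nmX nm_cis expr1n.
  rewrite hornerD Qh [X in nm X](_ : _ = (psi t - P.[cis t] - p.[cis t])
     - p.[cis t] * (cis t ^+ m * g.[cis t ^+ m] - 1)); last by ring.
  rewrite (le_trans (nmB _ _))// (splitr e) lerD// nmM.
  rewrite (@le_trans _ _ (M * (e / 2 / M)))//; last by rewrite mulrC divfK ?gt_eqF.
  by rewrite ler_pM ?nm_ge0// (le_trans (nm_horner_cis _ _))// lerDl.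
move=> rho rho01; have /andP[rho0 rho1] := rho01.
have nrho : nm (rho%:C * cis t) = rho by rewrite nmM nm_cis mulr1 nmR ger0_norm.
have N0 := nm_ge0 (psi t - P.[cis t]).
have [rr|rr] := leP rho r'.
  rewrite (le_trans (@nm_horner_le _ Q _ r' _)) ?nrho// (le_trans Qr')//.
  rewrite -[leLHS]mul1r ler_pM//; first exact: ltW.
    by rewrite lerDr ltW.
  by rewrite lerDr.
have [H _] := gP _ (conem rho rho01).
rewrite Qh nmM mulrC (@le_trans _ _ (K * nm p.[rho%:C * cis t]))//.
  by rewrite ler_wpM2r ?nm_ge0.
rewrite ler_pM ?nm_ge0 ?lerDl// ?(ltW K0)//.
rewrite -[p.[_]](subrK p.[cis t]) (le_trans (nmD _ _))//.
have := pL (rho%:C * cis t) (cis t).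
rewrite nrho nm_cis => /(_ rho1 (lexx _)).
have -> : nm (rho%:C * cis t - cis t) = 1 - rho.
  rewrite -{2}[cis t]mul1r -mulrBl nmM nm_cis mulr1.
  by rewrite -(rmorph1 (real_complex R)) -rmorphB/= nmR ler0_norm ?opprB// subr_le0.
have : L * (1 - rho) <= e / 2.
  rewrite -ler_pdivlMl// mulrC; lra.
by lra.
Qed.

End StepLemma.

(** * Summing the corrections *)

Section RadialLimits.
Context {R : realType}.
Local Notation mu := (@lebesgue_measure R).
Local Notation h := (2^-1 : R).
Implicit Types (P Q : {poly R[i]}) (e : R).

Lemma ReB (x y : R[i]) : complex.Re (x - y) = complex.Re x - complex.Re y.
Proof. by case: x; case: y. Qed.

Lemma ImB (x y : R[i]) : complex.Im (x - y) = complex.Im x - complex.Im y.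
Proof. by case: x; case: y. Qed.

Lemma half_small e : 0 < e -> exists n0, forall n, (n0 <= n)%N -> h ^+ n <= e.
Proof. by apply: expr_small; lra. Qed.

Lemma real_cauchy (v : nat -> R) :
  (forall e, 0 < e -> exists N, forall n, (N <= n)%N -> `|v n - v N| <= e) ->
  exists l, forall e, 0 < e -> exists N, forall n, (N <= n)%N -> `|l - v n| <= e.
Proof.
move=> vN; have : cvg (v @ \oo).
  apply/cauchy_cvgP; apply: cauchy_exP => e e0.
  have [|N HN] := vN (e / 2); first by rewrite divr_gt0.
  exists (v N); exists N => // n /= Nn; rewrite /ball/= distrC.
  by rewrite (le_lt_trans (HN n Nn))//; lra.
move=> /cvg_ex[l vl]; exists l => e e0.
by have /cvgrPdist_le/(_ e e0)[N _ HN] := vl; exists N => n Nn; exact: HN.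
Qed.

Lemma geometric_dist (u : nat -> R[i]) n0 K :
  (forall n, (n0 <= n)%N -> nm (u n.+1 - u n) <= K * h ^+ n) ->
  forall n m, (n0 <= n)%N -> nm (u (n + m)%N - u n) <= 2 * K * h ^+ n.
Proof.
move=> uK n m n0n.
have K0 : 0 <= K * h ^+ n by rewrite (le_trans (nm_ge0 _) (uK n n0n)).
(* The bound is strengthened to the exact geometric sum, so that the induction closes. *)
have : nm (u (n + m)%N - u n) <= 2 * K * (h ^+ n - h ^+ (n + m)).
  elim: m => [|m ih]; first by rewrite addn0 !subrr nm0 mulr0.
  have nm0' : (n0 <= n + m)%N by rewrite (leq_trans n0n)// leq_addr.
  rewrite addnS (le_trans (nm_tri (u (n + m)%N) _ _))//.
  by have := uK _ nm0'; rewrite exprS; lra.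
move=> /le_trans; apply; rewrite mulrBr gerBl exprD.
have -> : 2 * K * (h ^+ n * h ^+ m) = 2 * (K * h ^+ n) * h ^+ m by ring.
by rewrite mulr_ge0 ?exprn_ge0// mulr_ge0.
Qed.

Lemma geometric_cauchy (u : nat -> R[i]) n0 K :
  (forall n, (n0 <= n)%N -> nm (u n.+1 - u n) <= K * h ^+ n) ->
  exists l, forall e, 0 < e -> exists N, forall n, (N <= n)%N -> nm (l - u n) <= e.
Proof.
move=> uK.
have K0 : 0 <= K.
  rewrite -(pmulr_lge0 _ (_ : 0 < h ^+ n0)) ?exprn_gt0//.
  by rewrite (le_trans (nm_ge0 _) (uK n0 (leqnn _))).
have key e : 0 < e -> exists N, forall n, (N <= n)%N -> nm (u n - u N) <= e.
  move=> e0; have e1 : 0 < e / (2 * K + 1) by rewrite divr_gt0// ltr_wpDl// mulr_ge0.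
  have [n1 hn1] := half_small e1.
  exists (maxn n0 n1) => n Nn; rewrite -(subnKC Nn).
  rewrite (le_trans (geometric_dist uK _ _))// ?leq_maxl//.
  have := hn1 _ (leq_maxr n0 n1); rewrite ler_pdivlMr; last by rewrite ltr_wpDl// mulr_ge0.
  have : 0 <= h ^+ maxn n0 n1 by rewrite exprn_ge0.
  by lra.
have [|a Ha] := @real_cauchy (fun n => complex.Re (u n)).
  move=> e /key[N HN]; exists N => n /HN; apply: le_trans.
  by rewrite -ReB Re_le_nm.
have [|b Hb] := @real_cauchy (fun n => complex.Im (u n)).
  move=> e /key[N HN]; exists N => n /HN; apply: le_trans.
  by rewrite -ImB Im_le_nm.
exists (a +i* b) => e e0; have e2 : 0 < e / 2 by rewrite divr_gt0.
have [N1 H1] := Ha _ e2; have [N2 H2] := Hb _ e2.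
exists (maxn N1 N2) => n; rewrite geq_max => /andP[/H1 h1 /H2 h2].
rewrite (le_trans (nm_le_ReIm _))// (splitr e).
by move: h1 h2 => /=; case: (u n) => x y /= h1 h2; rewrite lerD.
Qed.

Lemma nm_limit_le (u : nat -> R[i]) l a b n0 :
  (forall e, 0 < e -> exists N, forall n, (N <= n)%N -> nm (l - u n) <= e) ->
  (forall n, (n0 <= n)%N -> nm (u n - a) <= b) -> nm (l - a) <= b.
Proof.
move=> ul ub; apply/ler_addgt0Pr => e e0; have [N HN] := ul e e0.
rewrite (le_trans (nm_tri (u (maxn n0 N)) _ _))// addrC lerD//.
  by rewrite ub// leq_maxl.
by rewrite HN// leq_maxr.
Qed.

(** A quadratic remainder bound passes directly to limits of polynomials once the constants are
    uniform. *)
Definition has_complex_derivative (F : R[i] -> R[i]) z := exists L K d,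
  0 < d /\ forall x, nm (x - z) <= d ->
    nm (F x - F z - L * (x - z)) <= K * nm (x - z) ^+ 2.

Definition psum (Q : nat -> {poly R[i]}) n := \sum_(k < n) Q k.

Lemma psumS (Q : nat -> {poly R[i]}) n : psum Q n.+1 = psum Q n + Q n.
Proof. by rewrite /psum big_ord_recr. Qed.

(** On each smaller disk the majorants are eventually dominated by a geometric series. Values and
    derivatives of the partial sums therefore converge, and [nm_taylor_le] holds with one constant
    for all late partial sums, hence for the limit. *)
Lemma holomorphic_limit (Q : nat -> {poly R[i]}) :
  (forall n, majorant (Q n) (1 - h ^+ n) <= h ^+ n) ->
  exists F : R[i] -> R[i], forall z, nm z < 1 -> has_complex_derivative F z /\
    forall e, 0 < e -> exists N, forall n, (N <= n)%N -> nm (F z - (psum Q n).[z]) <= e.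
Proof.
move=> Qh.
have tail s : 0 <= s -> s < 1 -> exists n0, forall n, (n0 <= n)%N ->
    majorant (Q n) s <= h ^+ n.
  move=> s0 s1; have [|n0 hn0] := @half_small (1 - s); first by rewrite subr_gt0.
  exists n0 => n /hn0 hn; rewrite (le_trans _ (Qh n))// majorant_le//; lra.
have conv z : exists l, nm z < 1 -> forall e, 0 < e ->
    exists N, forall n, (N <= n)%N -> nm (l - (psum Q n).[z]) <= e.
  have [z1|z1] := ltP (nm z) 1; last by exists 0.
  have [n0 hn0] := tail _ (nm_ge0 z) z1.
  have [|l Hl] := @geometric_cauchy (fun n => (psum Q n).[z]) n0 1.
    move=> n /hn0 hn; rewrite psumS hornerD addrC addKr mul1r.
    by rewrite (le_trans _ hn)// nm_horner_le.
  by exists l.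
have [F HF] := choice conv; exists F => z z1; split; last exact: HF.
(* Two margins of width [d] fit before the unit circle: one for the points near [z], one for the
   Cauchy-type estimates. *)
pose d := (1 - nm z) / 4; pose s := nm z + d.
have d0 : 0 < d by rewrite /d; lra.
have s0 : 0 <= s by rewrite addr_ge0 ?nm_ge0// ltW.
have sd1 : s + d < 1 by rewrite /s /d; lra.
have sd0 : 0 <= s + d by rewrite addr_ge0// ltW.
have s1 : s < 1 by lra.
have zs : nm z <= s by rewrite /s; lra.
have [n0 hn0] := tail _ sd0 sd1.
have [|L HL] := @geometric_cauchy (fun n => (psum Q n)^`().[z]) n0 d^-1.
  move=> n /hn0 hn; rewrite psumS derivD hornerD addrC addKr.
  rewrite mulrC ler_pdivlMr// (le_trans _ hn)//; exact: nm_deriv_le.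
(* The terms from [n0] on add at most the sum of the powers of 1/2, which is 2. *)
pose K := majorant (psum Q n0) (s + d) + 2.
have MK n : majorant (psum Q (n0 + n)) (s + d) <= K.
  have : majorant (psum Q (n0 + n)) (s + d) <=
      majorant (psum Q n0) (s + d) + 2 * (1 - h ^+ n).
    elim: n => [|n ih]; first by rewrite addn0 expr0 subrr mulr0 addr0.
    rewrite addnS psumS (le_trans (majorantD _ _ sd0))//.
    have := hn0 (n0 + n)%N (leq_addr _ _); rewrite exprD exprS.
    have : h ^+ n0 * h ^+ n <= 1 * h ^+ n.
      by rewrite ler_wpM2r ?exprn_ge0// exprn_ile1//; lra.
    by lra.
  by have : 0 <= h ^+ n by [rewrite exprn_ge0]; rewrite /K; lra.
exists L, (K / d ^+ 2), d; split => // x xz.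
have xs : nm x <= s.
  by rewrite -[x](subrK z) (le_trans (nmD _ _))// addrC lerD2l.
have Fx := HF x (le_lt_trans xs s1); have Fz := HF z z1.
apply/ler_addgt0Pr => e e0.
have e3 : 0 < e / 4 by rewrite divr_gt0.
have w0 : 0 < nm (x - z) + 1 by rewrite ltr_wpDl// nm_ge0.
have e4 : 0 < e / 4 / (nm (x - z) + 1) by rewrite divr_gt0.
have [N1 H1] := Fx _ e3; have [N2 H2] := Fz _ e3; have [N3 H3] := HL _ e4.
pose m := (n0 + maxn N1 (maxn N2 N3))%N.
have m1 : (N1 <= m)%N by rewrite /m (leq_trans (leq_maxl _ _) (leq_addl _ _)).
have m2 : (N2 <= m)%N.
  by rewrite /m (leq_trans (leq_maxl N2 N3))// (leq_trans (leq_maxr N1 _) (leq_addl _ _)).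
have m3 : (N3 <= m)%N.
  by rewrite /m (leq_trans (leq_maxr N2 N3))// (leq_trans (leq_maxr N1 _) (leq_addl _ _)).
have {}H1 := H1 m m1; have {}H2 := H2 m m2; have {}H3 := H3 m m3.
set p := psum Q m in H1 H2 H3.
have T := nm_taylor_le p xs zs d0.
have {}T : nm (p.[x] - p.[z] - p^`().[z] * (x - z)) <= K / d ^+ 2 * nm (x - z) ^+ 2.
  rewrite mulrAC ler_pdivlMr ?exprn_gt0// (le_trans T)// ler_wpM2r ?sqr_ge0//.
  exact: MK.
rewrite [X in nm X](_ : _ = (p.[x] - p.[z] - p^`().[z] * (x - z))
  + ((F x - p.[x]) - (F z - p.[z]) - (L - p^`().[z]) * (x - z))); last by ring.
rewrite (le_trans (nmD _ _))// lerD// (le_trans (nmB _ _))//.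
have h4 : nm ((L - p^`().[z]) * (x - z)) <= e / 4.
  rewrite nmM (@le_trans _ _ (e / 4 / (nm (x - z) + 1) * (nm (x - z) + 1)))//.
    by rewrite ler_pM ?nm_ge0// lerDl.
  by rewrite divfK// gt_eqF.
by have := nmB (F x - p.[x]) (F z - p.[z]); lra.
Qed.

(** Each correction is aimed at the error left by the previous ones. The exceptional sets have
    summable measures, so by Borel-Cantelli almost every angle lies in only finitely many of them;
    [A N] collects the angles avoiding all those from [N] on. *)
Lemma step_sequence (psi : R -> R[i]) : approximable psi ->
  exists (Q : nat -> {poly R[i]}) (A : nat -> set R),
  [/\ forall n, majorant (Q n) (1 - h ^+ n) <= h ^+ n,
      mu.-negligible [set t | 0 <= t < 2 * pi /\ forall N, ~ A N t] &
      forall N n t, (N < n)%N -> A N t ->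
        nm (psi t - (psum Q n).[cis t]) <= 2 * h ^+ n /\
        forall rho, 0 <= rho <= 1 -> nm (Q n).[rho%:C * cis t] <= 3 * h ^+ n].
Proof.
move=> psia.
have eta0 n : 0 < 1 / (2 ^ n.+1)%:R :> R by rewrite divr_gt0// ltr0n expn_gt0.
have /choice[C HC] : forall n, exists C, 0 < C /\ forall P (r e : R),
    0 <= r < 1 -> 0 < e -> exists Q, majorant Q r <= e /\
    small [set t | 0 <= t < 2 * pi /\ ~ step_good psi P Q C e t] (1 / (2 ^ n.+1)%:R).
  by move=> n; have [C C0 H] := approximation_step psia (eta0 n); exists C.
have C0 n : 0 < C n by case: (HC n).
have C1 n : 0 < 1 + C n by rewrite addr_gt0.
(* The error left at step [n] is multiplied by [C n.+1] at the next step, so both constants are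
   divided out in advance. *)
pose eps n := h ^+ n / ((1 + C n) * (1 + C n.+1)).
have hn0 n : 0 < h ^+ n by rewrite exprn_gt0.
have eps0 n : 0 < eps n by rewrite divr_gt0// mulr_gt0.
have r01 n : 0 <= 1 - h ^+ n < 1.
  by rewrite subr_ge0 exprn_ile1 ?gtrBl ?hn0//; lra.
have /choice[q Hq] : forall nP : nat * {poly R[i]}, exists Q,
    majorant Q (1 - h ^+ nP.1) <= eps nP.1 /\
    small [set t | 0 <= t < 2 * pi /\
      ~ step_good psi nP.2 Q (C nP.1) (eps nP.1) t] (1 / (2 ^ nP.1.+1)%:R).
  by move=> [n P] /=; case: (HC n) => _; apply.
pose P := fix P n := if n is n'.+1 then P n' + q (n', P n') else 0.
pose Q n := q (n, P n).
have PQ n : psum Q n = P n.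
  elim: n => [|n ih]; first by rewrite /psum big_ord0.
  by rewrite psumS ih.
have /choice[B HB] : forall n, exists B, [/\ measurable B,
   [set t | 0 <= t < 2 * pi /\ ~ step_good psi (P n) (Q n) (C n) (eps n) t] `<=` B
   & (mu B <= (1 / (2 ^ n.+1)%:R)%:E)%E].
  by move=> n; case: (Hq (n, P n)).
pose A N := [set t | 0 <= t < 2 * pi /\ forall n, (N <= n)%N -> ~ B n t].
have epsC n : eps n <= h ^+ n /\ C n * eps n <= h ^+ n /\ C n.+1 * eps n <= h ^+ n.
  have c0 := C0 n; have c1 := C0 n.+1; have hh := hn0 n.
  have D0 : 0 < (1 + C n) * (1 + C n.+1) by rewrite mulr_gt0.
  have cc : 0 < C n * C n.+1 by rewrite mulr_gt0.
  rewrite /eps !mulrA !ler_pdivrMr// -![C _ * h ^+ n]mulrC.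
  by rewrite -[X in X <= _]mulr1 !ler_pM2l//; split; [|split]; lra.
exists Q, A; split.
- move=> n; have [+ _] := Hq (n, P n) => /= /le_trans; apply.
  by case: (epsC n).
- have mB n : measurable (B n) by case: (HB n).
  have L0 : mu (lim_sup_set B) = 0%E.
    apply: (@lim_sup_set_cvg0 _ (measurableTypeR R)) => //.
    apply: (@le_lt_trans _ _ 1%:E); last exact: ltry.
    apply: le_trans (epsilon_trick0 xpredT (ler01 : 0 <= (1 : R))).
    by apply: lee_nneseries => // n _; case: (HB n).
  apply: (@negligibleS _ (measurableTypeR R) _ _ (lim_sup_set B)).
    move=> t /= [t2pi tA] N _; apply: contrapT => tB; apply: (tA N); split => //.
    by move=> n Nn Bt; apply: tB; exists n.
  apply/(@negligibleP _ (measurableTypeR R)) => //.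
  by apply: bigcapT_measurable => n; apply: bigcup_measurable => k _; exact: mB.
(* The accuracy of step [n] and the radius bound of step [n.+1] are combined, which is why [N < n]
   is strict in the statement. The factor 3 is 2 from the former error and 1 from the new
   tolerance. *)
move=> N [//|n] t Nn [t2pi tA]; rewrite PQ.
have good k : (N <= k)%N -> step_good psi (P k) (Q k) (C k) (eps k) t.
  move=> /tA tB; apply: contrapT => ng; apply: tB.
  by case: (HB k) => _ sB _; apply: sB.
have [g1 _] := good n Nn; have [_ g2] := good n.+1 (leqW Nn).
have [e1 [_ e2]] := epsC n; have [_ [e3 _]] := epsC n.+1.
have hS : h ^+ n = 2 * h ^+ n.+1 by rewrite exprS; lra.
have {}g1 : nm (psi t - (P n.+1).[cis t]) <= eps n by [].
split; first by rewrite (le_trans g1)// -hS.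
move=> rho /g2/le_trans; apply.
have : C n.+1 * nm (psi t - (P n.+1).[cis t]) <= C n.+1 * eps n.
  by rewrite ler_pM2l.
move: e2 e3; rewrite hS; set a := h ^+ n.+1; lra.
Qed.

(** One polynomial serves all angles of [A N] and all points of their radii. This uniformity later
    allows approaching a boundary point through neighbouring radii instead of its own. *)
Theorem radial_limits (psi : R -> R[i]) : approximable psi ->
  exists (F : R[i] -> R[i]) (P : nat -> {poly R[i]}) (A : nat -> set R),
  [/\ forall z, nm z < 1 -> has_complex_derivative F z,
      mu.-negligible [set t | 0 <= t < 2 * pi /\ forall N, ~ A N t] &
      forall N e, 0 < e -> exists n, forall t, A N t ->
        nm (psi t - (P n).[cis t]) <= e /\
        forall rho, 0 <= rho < 1 ->
          nm (F (rho%:C * cis t) - (P n).[rho%:C * cis t]) <= e].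
Proof.
move=> /step_sequence[Q [A [Qh nA QA]]].
have [F HF] := holomorphic_limit Qh.
exists F, (psum Q), A; split => //; first by move=> z /HF[].
move=> N e e0; have e6 : 0 < e / 6 by rewrite divr_gt0.
have [n0 hn0] := half_small e6.
have {}hn0 := hn0 (maxn n0 N.+1) (leq_maxl _ _).
have := leq_maxr n0 N.+1; move: hn0; set n := maxn _ _ => hn Nn.
exists n => t At; split.
  have [H _] := QA N n t Nn At; rewrite (le_trans H)//; lra.
move=> rho /andP[rho0 rho1].
have z1 : nm (rho%:C * cis t) < 1 by rewrite nmM nm_cis mulr1 nmR ger0_norm.
have [_ Fz] := HF _ z1.
apply: (nm_limit_le (n0 := n) Fz) => m nm'; rewrite -(subnKC nm').
apply: (@le_trans _ _ (2 * 3 * h ^+ n)); last by lra.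
apply: (@geometric_dist (fun k => (psum Q k).[rho%:C * cis t]) n) => // k nk.
rewrite psumS hornerD addrC addKr.
have [_ H] := QA N k t (leq_trans Nn nk) At; apply: H.
by rewrite rho0 ltW.
Qed.

End RadialLimits.

(** * Boundary behaviour along arcs *)

Section ComplexTopology.
Context {R : realType}.
Local Notation C := (Cplx R).
Local Notation mu := (@lebesgue_measure R).

Lemma gt0_complexE (e : C) : 0 < e -> e = (complex.Re e)%:C /\ 0 < complex.Re e.
Proof. by case: e => a b; rewrite ltcE/= => /andP[/eqP -> a0]. Qed.

Lemma cvg_nmP (T : Type) (F : set_system T) (FF : Filter F) (f : T -> C) (l : C) :
  f @ F --> l <-> forall e : R, 0 < e -> \forall x \near F, nm (f x - l) < e.
Proof.
split=> [/cvgrPdist_lt H e e0|H].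
  have /H : (0 : C) < e%:C by rewrite ltcR.
  by apply: filterS => x; rewrite distrC nmE ltcR.
apply/cvgrPdist_lt => e /gt0_complexE[-> e0]; apply: filterS (H _ e0) => x.
by rewrite distrC nmE ltcR.
Qed.

Lemma nbhs_nm (x : C) (P : set C) (e : R) : 0 < e ->
  (forall y, nm (y - x) < e -> P y) -> nbhs x P.
Proof.
move=> e0 H; have /cvg_nmP/(_ e e0) : (id : C -> C) @ nbhs x --> x by exact: cvg_id.
by apply: filterS.
Qed.

Lemma has_complex_derivativeP (F : C -> C) z :
  has_complex_derivative F z -> derivable F z 1.
Proof.
move=> [L [K [d [d0 H]]]]; apply/cvg_ex; exists (L : C).
apply/cvg_nmP => e e0.
pose M := `|K| + 1; have M0 : 0 < M by rewrite ltr_wpDl.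
have m0 : 0 < Num.min d (e / M) by rewrite lt_min d0 divr_gt0.
have : \forall x \near (0 : C), nm (x - 0) < Num.min d (e / M).
  by have /cvg_nmP := @cvg_id _ (nbhs (0 : C)); exact.
move=> H0; near=> x.
have x0 : x != 0 by near: x; exact: nbhs_dnbhs_neq.
have : nm (x - 0) < Num.min d (e / M) by near: x; exact: nbhs_dnbhs.
rewrite subr0 lt_min => /andP[xd xe].
rewrite /= /GRing.scale/= mulr1.
have := H (x + z); rewrite addrK => /(_ (ltW xd)) Hx.
have nx0 : 0 < nm x by rewrite lt_def nm_eq0 x0 nm_ge0.
have -> : x^-1 * (F (x + z) - F z) - L = x^-1 * (F (x + z) - F z - L * x).
  by field.
rewrite nmM nmV mulrC ltr_pdivrMr// (le_lt_trans Hx)//.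
apply: (@le_lt_trans _ _ (`|K| * nm x ^+ 2)).
  by rewrite ler_wpM2r ?sqr_ge0// ler_norm.
rewrite expr2 mulrA ltr_pM2r// (@le_lt_trans _ _ (M * nm x))//.
  by rewrite ler_wpM2r ?nm_ge0// lerDl.
by rewrite mulrC -ltr_pdivlMr.
Unshelve. all: by end_near. Qed.

Lemma derivable_comp1 (f g : C -> C) z :
  derivable f z 1 -> derivable g (f z) 1 -> derivable (g \o f) z 1.
Proof.
move=> /derivable1_diffP df /derivable1_diffP dg; apply/derivable1_diffP.
have dgf := @differentiable_comp _ _ _ _ f g z df dg.
exact: dgf.
Qed.

Lemma cis_continuous (t e : R) : 0 < e ->
  exists2 d, 0 < d & forall s, `|s - t| < d -> nm (cis s - cis t) < e.
Proof.
move=> e0; have e2 : 0 < e / 2 by rewrite divr_gt0.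
have /cvgrPdist_lt/(_ _ e2) hc := @continuous_cos R t.
have /cvgrPdist_lt/(_ _ e2) hs := @continuous_sin R t.
have /nbhs_ballP[d /= d0 hd] : \forall s \near t,
    `|cos t - cos s| < e / 2 /\ `|sin t - sin s| < e / 2.
  by near=> s; split; near: s.
exists d => // s; rewrite distrC => /hd[h1 h2].
rewrite (le_lt_trans (nm_le_ReIm _))// (splitr e).
by rewrite ReB ImB/= ltrD// distrC.
Unshelve. all: by end_near. Qed.

Lemma negligible_subsingletons (G : nat -> set R) :
  (forall k x y, G k x -> G k y -> x = y) -> mu.-negligible (\bigcup_k G k).
Proof.
move=> Gk; apply: (@negligible_bigcup _ (measurableTypeR R)) => k.
have [[x Gx]|nG] := pselect (exists x, G k x).
  apply: (@negligibleS _ (measurableTypeR R)) (negligible_set1 x) => y Gy.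
  exact: Gk Gy Gx.
apply: (@negligibleS _ (measurableTypeR R)) (negligible_set1 0) => y Gy.
by exfalso; apply: nG; exists y.
Qed.

Definition bilateral_limit_point (A : set R) (t : R) := A t /\
  forall d, 0 < d -> (exists2 s, A s & t - d < s < t) /\
                     (exists2 s, A s & t < s < t + d).

(** A point of [A] isolated on the left is the first point of [A] after some rational number, and a
    rational number determines at most one such point; likewise on the right. Hence the exceptional
    points are countable. *)
Lemma negligible_not_bilateral (A : set R) :
  mu.-negligible [set t | A t /\ ~ bilateral_limit_point A t].
Proof.
have [q qlt] : exists q : nat -> R, forall x y, x < y -> exists k, x < q k < y.
  exists (fun k => ratr (odflt 0%Q (unpickle k))) => x y /rat_in_itvoo[r].
  by rewrite in_itv/= => xry; exists (pickle r); rewrite pickleK.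
pose G k := [set t | A t /\ q k < t /\ forall s, q k < s < t -> ~ A s].
pose G' k := [set t | A t /\ t < q k /\ forall s, t < s < q k -> ~ A s].
have nG : mu.-negligible (\bigcup_k G k).
  apply: negligible_subsingletons => k x y [Ax [qx Hx]] [Ay [qy Hy]].
  have [xy|yx|//] := ltgtP x y.
    by exfalso; apply: (Hy x) => //; rewrite qx.
  by exfalso; apply: (Hx y) => //; rewrite qy.
have nG' : mu.-negligible (\bigcup_k G' k).
  apply: negligible_subsingletons => k x y [Ax [qx Hx]] [Ay [qy Hy]].
  have [xy|yx|//] := ltgtP x y.
    by exfalso; apply: (Hx y) => //; rewrite xy.
  by exfalso; apply: (Hy x) => //; rewrite yx.
apply: (@negligibleS _ (measurableTypeR R)); last first.
  exact: (@negligibleU _ (measurableTypeR R) _ _ _ _ nG nG').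
move=> t /= [At nt]; apply: contrapT => tG; apply: nt; split => // d d0; split.
  have /qlt[k /andP[dk kt]] : t - d < t by rewrite gtrBl.
  apply: contrapT => ns; apply: tG; left; exists k => //.
  split => //; split => // s /andP[ks st] As.
  by apply: ns; exists s => //; rewrite st (lt_trans dk).
have /qlt[k /andP[tk kd]] : t < t + d by rewrite ltrDl.
apply: contrapT => ns; apply: tG; right; exists k => //.
split => //; split => // s /andP[ts sk] As.
by apply: ns; exists s => //; rewrite ts (lt_trans sk).
Qed.

End ComplexTopology.

(** * Arcs meet nearby radii *)

Section Crossing.
Context {R : realType}.
Local Notation C := (Cplx R).

Lemma near_left1 (P : R -> Prop) : (\forall u \near 1^'-, P u) ->
  exists2 S, S < 1 & forall u, S < u < 1 -> P u.
Proof.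
move=> /nbhs_ballP[d /= d0 H]; exists (1 - d); first by rewrite gtrBl.
move=> u /andP[u1 u2]; apply: H => //; rewrite /ball/= gtr0_norm ?subr_gt0//.
by rewrite ltrBlDr addrC -ltrBlDr.
Qed.

(** [k s u] is the signed distance of [G u] to the line through 0 and [cis s]. For [s] near [t] its
    sign at the parameter [S] is that of [k t S], while its limit at the end of the arc is
    [sin (t - s)], whose sign depends on the side of [s]. On one of the two sides the signs differ,
    and the arc crosses the line. *)
Lemma crossing (G : R -> C) (A : set R) (t T d : R) :
  {within `[0, 1[, continuous G} -> G u @[u --> 1^'-] --> (cis t : C) ->
  bilateral_limit_point A t -> T < 1 -> 0 < d ->
  exists u s, [/\ 0 <= u < 1, T < u, A s, G u = (nm (G u))%:C * cis s
    & nm (G u - cis t) < d].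
Proof.
move=> Gc G1 [At lA] T1 d0.
have left e : 0 < e -> exists2 S, S < 1 & forall u, S < u < 1 -> nm (G u - cis t) < e.
  by move=> e0; apply: near_left1; move/cvg_nmP : G1; exact.
(* The bound 1/2 keeps [G u] within distance 1 of [cis s], so that a crossing lies on the radius and
   not on the opposite ray. *)
have [d' [d'0 d'd d'2]] : exists d', [/\ 0 < d', d' <= d & d' <= 1 / 2].
  exists (Num.min d (1 / 2)).
  by split; rewrite ?lt_min ?d0 ?divr_gt0// ge_min lexx ?orbT.
have [S0 S01 HS0] := left _ d'0.
have [S [S0S TS S_gt0 S1]] : exists S, [/\ S0 < S, T < S, 0 < S & S < 1].
  have m1 : Num.max S0 (Num.max T 0) < 1 by rewrite !gt_max S01 T1 ltr01.
  exists ((Num.max S0 (Num.max T 0) + 1) / 2).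
  by have [] := midf_lt m1; rewrite !gt_max => /and3P[-> -> ->].
have HS u : S <= u < 1 -> nm (G u - cis t) < d'.
  by move=> /andP[Su u1]; apply: HS0; rewrite u1 (lt_le_trans S0S).
have [k kE] : exists k : R -> R -> R, forall s u, k s u = complex.Im (G u * cis (- s)).
  by exists (fun s u => complex.Im (G u * cis (- s))).
have kc s b : b < 1 -> {within `[S, b], continuous (k s)}.
  move=> b1; apply/subspace_continuousP => x /=; rewrite in_itv/= => /andP[Sx xb].
  have x01 : `[0, 1[%classic x by rewrite /= in_itv/=; apply/andP; split; lra.
  move/subspace_continuousP : Gc => /(_ x x01)/cvg_nmP Gx.
  apply/cvgrPdist_lt => e e0; have := Gx e e0; rewrite !near_withinE.
  apply: filterS => y H; rewrite /= in_itv/= => /andP[Sy yb].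
  have {}H := H (_ : `[0, 1[%classic y).
  rewrite -[_ < _]/(`|k s x - k s y| < e) distrC !kE -ImB -mulrBl.
  rewrite (le_lt_trans (Im_le_nm _))// nmM nm_cis mulr1.
  by apply: H; rewrite /= in_itv/=; apply/andP; split; lra.
(* A point close to [cis s] at which [k s] vanishes lies on the radius to [cis s]. *)
have radius s u : S <= u < 1 -> nm (cis s - cis t) < 1 / 2 -> k s u = 0 ->
    G u = (nm (G u))%:C * cis s.
  move=> Su st k0.
  set g := G u * cis (- s); have gG : G u = g * cis s.
    by rewrite /g -mulrA -cisD addNr cis0 mulr1.
  have Reg : 0 < complex.Re g.
    have := Re_le_nm ((G u - cis s) * cis (- s)).
    rewrite nmM nm_cis mulr1 mulrBl -cisD subrr cis0 ReB -/g ler_norml/= => /andP[h _].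
    have := nm_tri (cis t) (G u) (cis s); have := HS u Su; rewrite [nm (cis t - _)]nmBC.
    by lra.
  have gE : g = (complex.Re g)%:C.
    by rewrite [LHS]complexE -/g; move: k0; rewrite kE -/g => ->; rewrite mulr0 addr0.
  by rewrite {2}gG nmM nm_cis mulr1 gE nmR gtr0_norm// -gE.
have half0 : 0 < (1 / 2 : R) by [].
have finish s u : S <= u < 1 -> A s -> nm (cis s - cis t) < 1 / 2 -> k s u = 0 ->
    exists u s, [/\ 0 <= u < 1, T < u, A s, G u = (nm (G u))%:C * cis s
      & nm (G u - cis t) < d].
  move=> Su As st k0; have /andP[Su1 u1] := Su; exists u, s; split => //.
  - by rewrite u1 andbT (le_trans (ltW S_gt0)).
  - exact: lt_le_trans Su1.
  - exact: radius.
  - by rewrite (lt_le_trans (HS u Su)).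
have SS : S <= S < 1 by rewrite lexx.
(* If the arc is already on the radius of [t] itself, then [s = t] works since [A t] holds. *)
have [kt0|kt0] := eqVneq (k t S) 0.
  by apply: (finish t S) => //; rewrite subrr nm0.
have [e [e0 e2 ek]] : exists e, [/\ 0 < e, e <= 1 / 2 & e <= `|k t S| / 2].
  exists (Num.min (1 / 2) (`|k t S| / 2)).
  by split; rewrite ?ge_min ?lexx ?orbT// lt_min half0 divr_gt0// normr_gt0.
have [rho rho0 Hrho] := @cis_continuous R t e e0.
have [r [r0 rrho r1]] : exists r, [/\ 0 < r, r <= rho & r <= 1].
  by exists (Num.min rho 1); split; rewrite ?ge_min ?lexx ?orbT// lt_min rho0 ltr01.
have kdiff s : `|k s S - k t S| <= 2 * nm (cis s - cis t).
  rewrite !kE -ImB -mulrBr (le_trans (Im_le_nm _))// nmM.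
  have -> : cis (- s) - cis (- t) = cis (- s - t) * (cis t - cis s).
    by rewrite mulrBr -!cisD subrK addrAC addNr add0r.
  rewrite nmM nm_cis mul1r nmBC ler_wpM2r ?nm_ge0//.
  have := nm_sub_le (G S) (cis t); have := HS S SS; rewrite nm_cis.
  clear -d'2; lra.
have pi2 := @pi_ge2 R.
(* By the intermediate value theorem [k s] vanishes somewhere as soon as [k s S]
   and [sin (t - s)], the limit of [k s] at [1], have opposite signs. *)
have ivt s : A s -> `|s - t| < r -> k s S * sin (t - s) < 0 ->
    exists u s, [/\ 0 <= u < 1, T < u, A s, G u = (nm (G u))%:C * cis s
      & nm (G u - cis t) < d].
  move=> As sr kk.
  have st : nm (cis s - cis t) < 1 / 2.
    apply: lt_le_trans e2.
    by apply: Hrho; rewrite (lt_le_trans sr).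
  have sn0 : 0 < `|sin (t - s)|.
    by rewrite normr_gt0; apply: contraTneq kk => ->; rewrite mulr0 ltxx.
  have [S2 S21 HS2] := left _ sn0.
  have [v [/ltW Sv S2v v1]] : exists v, [/\ S < v, S2 < v & v < 1].
    have M1 : Num.max S S2 < 1 by rewrite gt_max S1 S21.
    exists ((Num.max S S2 + 1) / 2).
    by have [] := midf_lt M1; rewrite gt_max => /andP[-> ->].
  have kv : `|k s v - sin (t - s)| < `|sin (t - s)|.
    have -> : sin (t - s) = complex.Im (cis t * cis (- s)) by rewrite -cisD.
    rewrite kE -ImB -mulrBl (le_lt_trans (Im_le_nm _))// nmM nm_cis mulr1.
    by rewrite -cisD; apply: HS2; rewrite S2v.
  have [|u uSv ku] := IVT (v := 0) Sv (kc s v v1).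
    rewrite ge_min le_max; move: kk kv.
    have [sp|sp|<-] := ltgtP 0 (sin (t - s)); last by rewrite mulr0 ltxx.
    - rewrite pmulr_llt0// (gtr0_norm sp) ltr_norml => h1 /andP[h2 h3].
      by apply/andP; split; apply/orP; [left|right]; clear -h1 h2 h3; lra.
    - rewrite nmulr_llt0// (ltr0_norm sp) ltr_norml => h1 /andP[h2 h3].
      by apply/andP; split; apply/orP; [right|left]; clear -h1 h2 h3; lra.
  apply: (finish s u) => //; move: uSv; rewrite in_itv/= => /andP[-> uv].
  by rewrite (le_lt_trans uv).
have [[s As /andP[s1 s2]] [s' As' /andP[s1' s2']]] := lA r r0.
have kclose s0 : `|s0 - t| < r -> `|k s0 S - k t S| < `|k t S|.
  move=> h; rewrite (le_lt_trans (kdiff s0))// -ltr_pdivlMl// mulrC.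
  apply: lt_le_trans ek.
  by apply: Hrho; rewrite (lt_le_trans h).
have hs : `|s - t| < r by rewrite ltr_norml; apply/andP; split; clear -s1 s2 r0; lra.
have hs' : `|s' - t| < r.
  by rewrite ltr_norml; apply/andP; split; clear -s1' s2' r0; lra.
have := kclose s hs; have := kclose s' hs'.
have sgt : 0 < sin (t - s).
  by apply: sin_gt0_pi; apply/andP; split; clear -s1 s2 r1 pi2; lra.
have slt : sin (t - s') < 0.
  by rewrite -[t - s']opprB sinN oppr_lt0; apply: sin_gt0_pi; apply/andP;
    split; clear -s1' s2' r1 pi2; lra.
(* The side of [t] is selected so that the end sign is opposite to that of [k t S]; a limit point
   from both sides makes either choice possible. *)
have [kp|kn] := ltP 0 (k t S).
  rewrite (gtr0_norm kp) !ltr_norml => /andP[h1 h2] /andP[h3 h4].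
  by apply: (ivt s') => //; rewrite nmulr_llt0//; clear -h1 h2; lra.
rewrite (ler0_norm kn) !ltr_norml => /andP[h1 h2] /andP[h3 h4].
by apply: (ivt s) => //; rewrite pmulr_llt0//; clear -h3 h4; lra.
Qed.

End Crossing.

(** * Transport to the unit disk and principal values *)

Section BoundaryValues.
Context {R : realType}.
Local Notation C := (Cplx R).
Context (D : set C) (w w' : C -> C).
Context (wD : w @` D = @open_disk R)
  (wcD : w @` closure D = @closed_disk R)
  (w_cont : {within closure D, continuous w})
  (w'K : forall z, closure D z -> w' (w z) = z)
  (w'_cont : {within @closed_disk R, continuous w'}).

Lemma open_diskE (z : C) : open_disk z <-> nm z < 1.
Proof. by rewrite /open_disk/= nmE ltcR. Qed.

Lemma closed_diskE (z : C) : closed_disk z <-> nm z <= 1.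
Proof. by rewrite /closed_disk/= nmE lecR. Qed.

Lemma conformal_lt1 z : D z -> nm (w z) < 1.
Proof. by move=> Dz; apply/open_diskE; rewrite -wD; exists z. Qed.

Lemma conformal_inverse x : nm x < 1 -> D (w' x) /\ w (w' x) = x.
Proof.
move=> /open_diskE; rewrite -wD => -[z Dz <-].
by rewrite w'K//; exact: subset_closure.
Qed.

Lemma boundary_inverse t : bdry D (w' (cis t)) /\ w (w' (cis t)) = cis t.
Proof.
have : closed_disk (cis t : C) by apply/closed_diskE; rewrite nm_cis.
rewrite -wcD => -[z cz wz]; rewrite -wz w'K//; split => //; split => // Dz.
by have := conformal_lt1 Dz; rewrite wz nm_cis ltxx.
Qed.

Lemma pullbackE (P : C -> Prop) : circle_pullback (w @` [set z | bdry D z /\ P z])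
  = [set t | 0 <= t < 2 * pi /\ P (w' (cis t))].
Proof.
apply/seteqP; split => t /= [t2pi].
  move=> [z [bz Pz] wz]; split => //; rewrite /cis -wz w'K//.
  by case: bz.
by move=> Pt; split => //; have [bt wt] := boundary_inverse t; exists (w' (cis t)).
Qed.

Lemma open_Re_lt (a e : R) : open [set z : C | `|complex.Re z - a| < e].
Proof.
rewrite openE => z /= ze; apply: (@nbhs_nm _ _ _ (e - `|complex.Re z - a|)).
  by rewrite subr_gt0.
move=> y yz /=; rewrite -(subrKA (complex.Re z)) (le_lt_trans (ler_normD _ _))//.
by rewrite -ltrBrDr (le_lt_trans _ yz)// -ReB Re_le_nm.
Qed.

Lemma open_Im_lt (a e : R) : open [set z : C | `|complex.Im z - a| < e].
Proof.
rewrite openE => z /= ze; apply: (@nbhs_nm _ _ _ (e - `|complex.Im z - a|)).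
  by rewrite subr_gt0.
move=> y yz /=; rewrite -(subrKA (complex.Im z)) (le_lt_trans (ler_normD _ _))//.
by rewrite -ltrBrDr (le_lt_trans _ yz)// -ImB Im_le_nm.
Qed.

Lemma open_dist_lt (a e : R) : 0 < e -> open [set x : R | `|x - a| < e].
Proof.
move=> e0; rewrite (_ : [set _ | _] = ball a e); first exact: ball_open.
by apply/seteqP; split => x; rewrite /ball/= distrC.
Qed.

Lemma approximable_boundary (lam : C -> C) (phi : C -> R) :
  hm_measurable_fun D w lam -> hm_measurable_fun D w phi ->
  approximable (fun t => lam (w' (cis t))) /\
  approximable (fun t => (phi (w' (cis t)))%:C).
Proof.
move=> lm pm; split; last first.
  apply: approximable_real => a e e0.
  have := pm _ (@open_dist_lt a e e0); rewrite /hm_measurable_set.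
  by rewrite (pullbackE (fun z => `|phi z - a| < e)).
have hR : approximable (fun t => (complex.Re (lam (w' (cis t))))%:C).
  apply: (@approximable_real _ (fun t => complex.Re (lam (w' (cis t))))) => a e e0.
  have := lm _ (@open_Re_lt a e); rewrite /hm_measurable_set.
  by rewrite (pullbackE (fun z => `|complex.Re (lam z) - a| < e)).
have hI : approximable (fun t => (complex.Im (lam (w' (cis t))))%:C).
  apply: (@approximable_real _ (fun t => complex.Im (lam (w' (cis t))))) => a e e0.
  have := lm _ (@open_Im_lt a e); rewrite /hm_measurable_set.
  by rewrite (pullbackE (fun z => `|complex.Im (lam z) - a| < e)).
have := approximableD hR (approximableM (approximable_cst 'i) hI).
by apply: eq_approximable => t _; rewrite -complexE.
Qed.

(* [F] tends to [psi t] along the radii ending in [A], uniformly in the radius *)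
Definition radial_limit_at (F : C -> C) (psi : R -> C) (A : set R) (t : R) :=
  forall e, 0 < e -> exists2 d, 0 < d & forall x s, nm x < 1 -> A s ->
    x = (nm x)%:C * cis s -> nm (x - cis t) < d -> nm (F x - psi t) <= e.

(** The polynomial [P n] is close to [F] on every radius ending in [A], close to [psi] at [t], and
    continuous up to the circle, so it links values on nearby radii to [psi t]. *)
Lemma radial_limit_atP (F : C -> C) (P : nat -> {poly R[i]}) psi A t :
  (forall e, 0 < e -> exists n, forall t, A t ->
        nm (psi t - (P n).[cis t]) <= e /\
        forall rho, 0 <= rho < 1 ->
          nm (F (rho%:C * cis t) - (P n).[rho%:C * cis t]) <= e) ->
  A t -> radial_limit_at F psi A t.
Proof.
move=> H At e e0; have e3 : 0 < e / 3 by rewrite divr_gt0.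
have [n Hn] := H _ e3; have [L L0 HL] := horner_lipschitz (P n).
exists (e / 3 / L); first by rewrite divr_gt0.
move=> x s x1 As xE xd; have [h1 _] := Hn t At; have [_ h2] := Hn s As.
have {}h2 : nm (F x - (P n).[x]) <= e / 3.
  by rewrite xE; apply: h2; rewrite nm_ge0.
have h3 : nm ((P n).[x] - (P n).[cis t]) <= e / 3.
  rewrite (le_trans (HL _ _ (ltW x1) _)) ?nm_cis// -ler_pdivlMl// mulrC.
  exact: ltW.
rewrite nmBC in h1.
have := nm_tri (P n).[x] (F x) (psi t).
have := nm_tri (P n).[cis t] (P n).[x] (psi t).
by lra.
Qed.

Lemma within_cvg_seq (f : C -> C) (B : set C) (z : C) (u : nat -> C) :
  {within B, continuous f} -> B z -> (forall n, B (u n)) -> u @ \oo --> z ->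
  (f \o u) @ \oo --> f z.
Proof.
move=> /subspace_continuousP/(_ z) fc Bz Bu uz; apply/cvg_nmP => e e0.
have /cvg_nmP/(_ e e0) := fc Bz; rewrite near_withinE => /uz[N _ HN].
exists N => // n Nn; exact: HN n Nn (Bu n).
Qed.

Lemma cvg_left1_seq (f : R -> C) (l : C) (u : nat -> R) :
  f x @[x --> 1^'-] --> l -> (forall n, 1 - n.+1%:R^-1 < u n < 1) ->
  (fun n => f (u n)) @ \oo --> l.
Proof.
move=> fl un; apply/cvg_nmP => e e0.
have [S S1 HS] : exists2 S, S < 1 & forall x, S < x < 1 -> nm (f x - l) < e.
  by apply: near_left1; move/cvg_nmP : fl; exact.
have S0 : 0 < 1 - S by rewrite subr_gt0.
near=> n; have /andP[u1 u2] := un n; apply: HS; rewrite u2 andbT (lt_trans _ u1)//.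
have : n.+1%:R^-1 < 1 - S by near: n; exact: (near_infty_natSinv_lt (PosNum S0)).
by rewrite !ltrBrDr addrC.
Unshelve. all: by end_near. Qed.

Lemma radius_arc t : arc_to D (w' (cis t)) (fun u => w' (u%:C * cis t)).
Proof.
have nr u : 0 <= u -> nm (u%:C * cis t) = u.
  by move=> u0; rewrite nmM nm_cis mulr1 nmR ger0_norm.
have c1 : closed_disk (cis t : C) by apply/closed_diskE; rewrite nm_cis.
have near_cvg u : 0 <= u <= 1 -> forall e, 0 < e -> exists2 d, 0 < d &
    forall v, 0 <= v <= 1 -> `|v - u| < d ->
      nm (w' (v%:C * cis t) - w' (u%:C * cis t)) < e.
  move=> /andP[u0 u1] e e0.
  have cu : closed_disk (u%:C * cis t : C) by apply/closed_diskE; rewrite nr.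
  move/subspace_continuousP : w'_cont => /(_ _ cu)/cvg_nmP/(_ e e0).
  rewrite near_withinE => /nbhs_ballP[d /= /gt0_complexE[dE d0] H].
  exists (complex.Re d) => // v /andP[v0 v1] vu; apply: H; last first.
    by apply/closed_diskE; rewrite nr.
  rewrite /ball/= nmE dE ltcR -mulrBl nmM nm_cis mulr1 -rmorphB/= nmR distrC//.
split; [|split; [|split]].
- apply/subspace_continuousP => u /=; rewrite in_itv/= => /andP[u0 u1].
  apply/cvg_nmP => e e0; have [|d d0 H] := near_cvg u _ e e0; first by rewrite u0 ltW.
  rewrite near_withinE; apply/nbhs_ballP; exists d => // v; rewrite /ball/= distrC => vu.
  by rewrite in_itv/= => /andP[v0 v1]; apply: H => //; rewrite v0 ltW.
- move=> s v /andP[s0 s1] /andP[v0 v1] E.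
  have {}E : s%:C * cis t = v%:C * cis t.
    have ns : nm (s%:C * cis t) < 1 by rewrite nr.
    have nv : nm (v%:C * cis t) < 1 by rewrite nr.
    have [_ <-] := conformal_inverse ns; have [_ <-] := conformal_inverse nv.
    by rewrite E.
  by have := mulIf (cis_neq0 t) E => -[].
- by move=> u /andP[u0 u1]; have [] := @conformal_inverse (u%:C * cis t); rewrite ?nr.
- apply/cvg_nmP => e e0.
  have [|d d0 H] := near_cvg 1 _ e e0; first by rewrite ler01 lexx.
  rewrite mul1r in H; near=> v; apply: H.
    apply/andP; split; last by apply: ltW; near: v; exact: nbhs_left_lt.
    by near: v; apply: nbhs_left_ge; exact: ltr01.
  rewrite ltr0_norm; last by rewrite subr_lt0; near: v; exact: nbhs_left_lt.
  by rewrite opprB; near: v; exact: nbhs_left_ltBl.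
Unshelve. all: by end_near. Qed.

(** The image of the radius under [w'] is one admissible arc, along which the limit exists, so no
    other value survives in the intersection. For an arbitrary arc, [crossing] is applied to its
    image under [w]. *)
Lemma principal_value (F : C -> C) (psi : R -> C) (A : set R) (t : R)
    (l : C) (c : R) :
  radial_limit_at F psi A t -> bilateral_limit_point A t -> nm l = 1 ->
  complex.Re (conjc l * psi t) = c ->
  principal_asymptotic_values D
    (fun z => ((complex.Re (conjc l * (F \o w) z))%:C : C)) (w' (cis t))
  = [set Some (c%:C : C)].
Proof.
move=> Ft At l1 <-.
have [bt wt] := boundary_inverse t.
have ct : closure D (w' (cis t)) by case: bt.
have dist z : nm ((complex.Re (conjc l * (F \o w) z))%:C
    - (complex.Re (conjc l * psi t))%:C) <= nm (F (w z) - psi t).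
  rewrite -rmorphB/= nmR -ReB -mulrBr (le_trans (Re_le_nm _))// nmM.
  have -> : nm (conjc l) = nm l by case: (l) => a b; rewrite /nm/= sqrrN.
  by rewrite l1 mul1r.
apply/seteqP; split => [v Pv|_ ->].
- have [z [zr [zt zv]]] := Pv _ (radius_arc t).
  have zD n : D (z n).
    have [u] := zr n; rewrite /= in_itv/= => /andP[u0 u1] <-.
    have [] // := @conformal_inverse (u%:C * cis t).
    by rewrite nmM nm_cis mulr1 nmR ger0_norm.
  have wz := within_cvg_seq w_cont ct (fun n => subset_closure (zD n)) zt.
  rewrite wt in wz.
  have key e : 0 < e -> \forall n \near \oo, nm ((complex.Re (conjc l * (F \o w) (z n)))%:C
      - (complex.Re (conjc l * psi t))%:C) <= e.
    move=> e0; have [d d0 Hd] := Ft e e0; have /cvg_nmP/(_ d d0) := wz.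
    apply: filterS => n /= wzd; rewrite (le_trans (dist _))//.
    have [u] := zr n; rewrite /= in_itv/= => /andP[u0 u1] uE.
    have nu : nm (u%:C * cis t) = u by rewrite nmM nm_cis mulr1 nmR ger0_norm.
    have wzE : w (z n) = u%:C * cis t.
      by rewrite -uE; case: (@conformal_inverse (u%:C * cis t)); rewrite ?nu.
    apply: (Hd _ t) => //; first exact: conformal_lt1.
    + by case: At.
    + by rewrite wzE nu.
  case: v Pv zv => [a|] Pv /= zv.
    congr Some; apply: (cvg_unique (@norm_hausdorff _ _) zv).
    apply/cvg_nmP => e e0; have e2 : 0 < e / 2 by rewrite divr_gt0.
    by apply: filterS (key _ e2) => n /le_lt_trans; apply; lra.
  (* Infinity is excluded because the values along the radius stay bounded near its end. *)
  have := zv (`|complex.Re (conjc l * psi t)| + 1) => {}zv.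
  have [n [h1 h2]] : exists n, (nm ((complex.Re (conjc l * (F \o w) (z n)))%:C
      - (complex.Re (conjc l * psi t))%:C) <= 1) /\
     (`|complex.Re (conjc l * psi t)| + 1)%:C
        < `|((complex.Re (conjc l * (F \o w) (z n)))%:C : C)|.
    near \oo => n; exists n; split; near: n => //; exact: key.
  move: h2; rewrite nmE ltcR nmR => h2; move: h1; rewrite -rmorphB/= nmR.
  move=> h1; exfalso; move: h2; rewrite ltNge => /negP; apply.
  rewrite -[X in `|X| <= _](subrK (complex.Re (conjc l * psi t))).
  by rewrite (le_trans (ler_normD _ _))// addrC lerD2l.
- move=> g [gc [ginj [gD g1]]].
  pose G u := w (g u).
  have Gc : {within `[0, 1[, continuous G}.
    apply/subspace_continuousP => u u01.
    have Du : D (g u) by apply: gD; move: u01; rewrite /= in_itv.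
    apply/cvg_nmP => e e0.
    move/subspace_continuousP : w_cont => /(_ _ (subset_closure Du))/cvg_nmP/(_ e e0).
    rewrite near_withinE => H.
    move/subspace_continuousP : gc => /(_ _ u01) gu.
    have {}H : \forall v \near u, `[0, 1[%classic v -> closure D (g v) ->
      nm (w (g v) - w (g u)) < e := gu _ H.
    rewrite near_withinE; apply: filterS H => v H v01.
    have Dv : D (g v) by apply: gD; move: v01; rewrite /= in_itv.
    exact: H v01 (subset_closure Dv).
  have G1 : G u @[u --> 1^'-] --> (cis t : C).
    rewrite -wt; apply/cvg_nmP => e e0.
    move/subspace_continuousP : w_cont => /(_ _ ct)/cvg_nmP/(_ e e0).
    rewrite near_withinE => H.
    have {}H : \forall u \near 1^'-, closure D (g u) ->
      nm (w (g u) - w (w' (cis t))) < e := g1 _ H.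
    near=> u.
    have h : closure D (g u) -> nm (w (g u) - w (w' (cis t))) < e by near: u.
    have u0 : 0 <= u by near: u; apply: nbhs_left_ge; exact: ltr01.
    have u1 : u < 1 by near: u; exact: nbhs_left_lt.
    have Du : D (g u) by apply: gD; rewrite u0.
    exact: h (subset_closure Du).
  (* Crossings at parameters tending to 1, with tolerance [1 / (n + 1)], give a sequence on the arc
     that realises the value. *)
  have /choice[u Hu] : forall n, exists u, [/\ 0 <= u < 1, 1 - n.+1%:R^-1 < u
      & nm (F (G u) - psi t) <= n.+1%:R^-1].
    move=> n; have n0 : 0 < n.+1%:R^-1 :> R by rewrite invr_gt0.
    have [d d0 Hd] := Ft _ n0.
    have T1 : 1 - n.+1%:R^-1 < 1 :> R by rewrite gtrBl.
    have [u [s [u01 Tu As GE Gd]]] := crossing Gc G1 At T1 d0.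
    exists u; split => //; apply: (Hd _ s) => //.
    by apply: conformal_lt1; exact: gD.
  exists (g \o u); split; first by move=> n; exists (u n) => //; rewrite /= in_itv/=; case: (Hu n).
  split.
    by apply: (cvg_left1_seq g1) => n; case: (Hu n) => /andP[_ ->] ->.
  apply/cvg_nmP => e e0; near=> n; rewrite /= (le_lt_trans (dist _))//.
  have [_ _ /le_lt_trans] := Hu n; apply.
  by near: n; exact: (near_infty_natSinv_lt (PosNum e0)).
Unshelve. all: by end_near. Qed.

End BoundaryValues.

(** * Solutions of the boundary problem *)

Section Solutions.
Context {R : realType}.
Local Notation C := (Cplx R).
Local Notation mu := (@lebesgue_measure R).

Lemma norm1_nm (l : C) : `|l| = 1 -> nm l = 1.
Proof. by rewrite nmE => /complexI. Qed.

Lemma Re_conj_mul (l : C) (p b : R) : nm l = 1 ->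
  complex.Re (conjc l * (l * (p%:C + 'i * b%:C))) = p.
Proof.
move=> l1; have := sqr_nm l; rewrite l1 expr1n; case: l {l1} => x y /= xy.
by rewrite -[RHS]mul1r xy; ring.
Qed.

(** The prescribed boundary value is [lam * (phi + i b)], whose product with the conjugate of [lam]
    has real part [phi]. The second conclusion keeps the full radial limit, from which [b] can be
    recovered to prove independence. *)
Lemma boundary_solution (D : set C) (w w' : C -> C) (lam : C -> C) (phi : C -> R)
    (b : R -> R) :
  holomorphic_on D w -> w @` D = @open_disk R -> w @` closure D = @closed_disk R ->
  {within closure D, continuous w} -> (forall z, closure D z -> w' (w z) = z) ->
  {within @closed_disk R, continuous w'} ->
  (forall zeta, bdry D zeta -> `|lam zeta| = 1) ->
  hm_measurable_fun D w lam -> hm_measurable_fun D w phi ->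
  approximable (fun t => (b t)%:C) ->
  exists F : C -> C, S_set D w lam phi (F \o w) /\
    mu.-negligible [set t | 0 <= t < 2 * pi /\
      ~ F (rho%:C * cis t) @[rho --> 1^'-] -->
          (lam (w' (cis t)) * ((phi (w' (cis t)))%:C + 'i * (b t)%:C) : C)].
Proof.
move=> w_hol wD wcD w_cont w'K w'_cont lam1 lm pm ba.
pose psi t := lam (w' (cis t)) * ((phi (w' (cis t)))%:C + 'i * (b t)%:C).
have [la pa] := approximable_boundary wD wcD w'K lm pm.
have psia : approximable psi.
  exact: approximableM la (approximableD pa (approximableM (approximable_cst 'i) ba)).
have [F [P [A [Fhol nA FA]]]] := radial_limits psia.
pose bad := [set t | 0 <= t < 2 * pi /\ forall N, ~ bilateral_limit_point (A N) t].
have nbad : mu.-negligible bad.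
  pose B N := [set t | A N t /\ ~ bilateral_limit_point (A N) t].
  have nB : mu.-negligible (\bigcup_N B N).
    by apply: (@negligible_bigcup _ (measurableTypeR R)) => N; exact: negligible_not_bilateral.
  apply: (@negligibleS _ (measurableTypeR R)); last first.
    exact: (@negligibleU _ (measurableTypeR R) _ _ _ _ nA nB).
  move=> t [t2pi tb]; have [[N AN]|nAN] := pselect (exists N, A N t).
    by right; exists N => //; split.
  by left; split => // N AN; apply: nAN; exists N.
have lim N t : A N t -> radial_limit_at F psi (A N) t.
  by apply: radial_limit_atP => e; exact: FA.
exists F; split.
  split.
    move=> z Dz; apply: derivable_comp1; first exact: w_hol.
    by apply: has_complex_derivativeP; apply: Fhol; exact: (conformal_lt1 wD).
  (* With this form every angle of a point of the set is bad, and a boundary point outside the set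
     comes with a good angle. *)
  exists [set zeta | bdry D zeta /\
    forall t, 0 <= t < 2 * pi -> w zeta = cis t -> bad t].
  split; [by move=> z []|split].
    apply: (@negligibleS _ (measurableTypeR R)) nbad => t [t2pi [z [_ zbad] wz]].
    exact: zbad.
  move=> zeta bz nz.
  have [t [t2pi wz tb]] : exists t, [/\ 0 <= t < 2 * pi, w zeta = cis t & ~ bad t].
    apply: contrapT => H; apply: nz; split => // t t2pi wt.
    by apply: contrapT => nb; apply: H; exists t.
  have [N bN] : exists N, bilateral_limit_point (A N) t.
    apply: contrapT => H; apply: tb; split => // N bN.
    by apply: H; exists N.
  have zE : zeta = w' (cis t) by rewrite -wz w'K//; case: bz.
  rewrite {2}zE; apply: (principal_value wD wcD w_cont w'K w'_cont _ bN).
  - by apply: lim; case: bN.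
  - by apply: norm1_nm; exact: lam1.
  - by rewrite /psi -zE Re_conj_mul//; apply: norm1_nm; exact: lam1.
apply: (@negligibleS _ (measurableTypeR R)) nA => t /= [t2pi nlim]; split => // N AN.
apply: nlim; apply/cvg_nmP => e e0.
have e2 : 0 < e / 2 by rewrite divr_gt0.
have [d d0 Hd] := lim N t AN _ e2.
near=> r; have r0 : 0 <= r by near: r; apply: nbhs_left_ge; exact: ltr01.
have r1 : r < 1 by near: r; exact: nbhs_left_lt.
have nr : nm (r%:C * cis t) = r by rewrite nmM nm_cis mulr1 nmR ger0_norm.
apply: (@le_lt_trans _ _ (e / 2)); last by lra.
apply: (Hd _ t) => //; rewrite ?nr//.
rewrite -[X in nm (_ - X)]mul1r -mulrBl nmM nm_cis mulr1.
rewrite -(rmorph1 (real_complex R)) -rmorphB/= nmR ltr0_norm ?subr_lt0// opprB.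
by near: r; exact: nbhs_left_ltBl.
Unshelve. all: by end_near. Qed.

(** A matrix with [n + 1] rows and [n] columns has rank at most [n], hence a nonzero left kernel. *)
Lemma nontrivial_relation (K : fieldType) (n : nat) (c : 'I_n.+1 -> 'I_n -> K) :
  exists a : 'I_n.+1 -> K, (exists j, a j != 0) /\
    forall i, \sum_(k < n.+1) a k * c k i = 0.
Proof.
pose M := \matrix_(k < n.+1, i < n) c k i.
have : kermx M != 0.
  by rewrite kermx_eq0 /row_free neq_ltn (leq_ltn_trans (rank_leq_col M)).
move=> /rowV0Pn[a /sub_kermxP aM /rV0Pn[j aj]].
exists (a 0); split; first by exists j.
move=> i; have := congr1 (fun N : 'rV_n => N 0 i) aM; rewrite mxE [RHS]mxE => aMi.
by rewrite -[RHS]aMi; apply: eq_bigr => k _; rewrite mxE.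
Qed.

Lemma cvg_linear_combination (T : Type) (G : set_system T) (FG : Filter G) n
    (a : 'I_n -> C) (f : 'I_n -> T -> C) (l : 'I_n -> C) :
  (forall k, f k @ G --> l k) ->
  (fun t => \sum_(k < n) a k * f k t) @ G --> (\sum_(k < n) a k * l k : C).
Proof.
move=> fl; apply: cvg_big => [|k _]; first exact: add_continuous.
by apply: cvgM; [exact: cvg_cst|exact: fl].
Qed.

End Solutions.

Theorem theorem5p3 (R : realType) (D : set (Cplx R)) (w : Cplx R -> Cplx R)
    (lam : Cplx R -> Cplx R) (phi : Cplx R -> R) :
  jordan_domain D ->
  caratheodory_conformal_map D w ->
  (forall zeta, bdry D zeta -> `|lam zeta| = 1) ->
  hm_measurable_fun D w lam ->
  hm_measurable_fun D w phi ->
  infinite_dimensional_affine D (S_set D w lam phi).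
Proof.
move=> _ [w_hol [wD [wcD [_ [w_cont [w' [w'K w'_cont]]]]]]] lam1 lm pm [n [g gspan]].
(* The free imaginary parts are the indicators of the disjoint arcs [I k]; on [I j] a
   linear relation between the solutions reduces to its [j]-th coefficient. *)
pose I (k : nat) := `]k%:R / n.+1%:R, k.+1%:R / n.+1%:R[%classic : set R.
have sol b ba := boundary_solution w_hol wD wcD w_cont w'K w'_cont lam1 lm pm ba (b := b).
have [F0 [SF0 lim0]] := sol (fun=> 0) (approximable_cst 0).
have Ia k : approximable (fun t => ((t \in I k)%:R : R)%:C).
  have := approximable_measurable (measurable_itv _ : measurable (I k)).
  by apply: eq_approximable => t _; rewrite /ind rmorph_nat.
have /choice[F HF] : forall k : 'I_n.+1, exists F : Cplx R -> Cplx R, _ :=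
  fun k => sol (fun t => (t \in I k)%:R) (Ia k).
have /choice[c Hc] : forall k, exists c : 'I_n -> R, forall z, D z ->
    F k (w z) - F0 (w z) = \sum_(i < n) (c i)%:C * g i z.
  by move=> k; have [SF _] := HF k; exact: gspan SF SF0.
have [a [[j aj] ac]] := nontrivial_relation c.
(* After exchanging the sums, the coefficient of each [g i] is the vanishing combination of the
   [c k i]. *)
have comb0 x : nm x < 1 -> \sum_(k < n.+1) (a k)%:C * (F k x - F0 x) = 0.
  move=> /(conformal_inverse wD w'K)[Dx <-].
  under eq_bigr do rewrite Hc// mulr_sumr.
  rewrite exchange_big/= big1// => i _.
  under eq_bigr do rewrite mulrA -rmorphM/=.
  rewrite -mulr_suml -rmorph_sum/=.
  by rewrite ac mul0r.
pose lim b (G : Cplx R -> Cplx R) t := G (rho%:C * cis t) @[rho --> 1^'-] -->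
  (lam (w' (cis t)) * ((phi (w' (cis t)))%:C + 'i * (b t)%:C) : Cplx R).
pose b k t : R := (t \in I k)%:R.
have n0 : 0 < n.+1%:R :> R by rewrite ltr0n.
have IE k t : I k t <-> k%:R < t * n.+1%:R < k.+1%:R.
  by rewrite /I/= in_itv/= ltr_pdivrMr// ltr_pdivlMr//.
have Ipi t : I j t -> 0 <= t < 2 * pi.
  move=> /IE/andP[h1 h2]; have pi2 := @pi_ge2 R.
  have t0 : 0 < t by rewrite -(pmulr_lgt0 _ n0) (le_lt_trans _ h1).
  have t1 : t < 1 by rewrite -(ltr_pM2r n0) mul1r (lt_le_trans h2)// ler_nat.
  by apply/andP; split; lra.
(* The arc [I j] has positive length, so it is not covered by the finitely many null sets where some
   radial limit fails. *)
have [t [It t0 tk]] : exists t, [/\ I j t, lim (fun=> 0) F0 t &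
    forall k : 'I_n.+1, lim (b k) (F k) t].
  apply: contrapT => H.
  (* The union is indexed by [nat]; [inord] reaches every index of ['I_n.+1], and larger [m] only
     repeat one. *)
  have nU : (@lebesgue_measure R).-negligible (\bigcup_m
      [set t | 0 <= t < 2 * pi /\ ~ lim (b (inord m : 'I_n.+1)) (F (inord m)) t]).
    apply: (@negligible_bigcup _ (measurableTypeR R)) => m.
    by have [_] := HF (inord m).
  have nI : (@lebesgue_measure R).-negligible (I j).
    apply: (@negligibleS _ (measurableTypeR R)); last first.
      exact: (@negligibleU _ (measurableTypeR R) _ _ _ _ lim0 nU).
    move=> t It; apply: contrapT => tU; apply: H; exists t; split; first exact: It.
      by apply: contrapT => h; apply: tU; left; split; [exact: Ipi|exact: h].
    move=> k; apply: contrapT => h; apply: tU; right; exists (k : nat); first by [].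
    split; first exact: Ipi.
    by rewrite inord_val; exact: h.
  have : @lebesgue_measure R (I j) = 0%E.
    exact: (@measure_negligible _ (measurableTypeR R) _ _ _ (measurable_itv _) nI).
  rewrite /I lebesgue_measure_itv/= lte_fin ltr_pM2r ?invr_gt0// ltr_nat ltnSn.
  rewrite -EFinB -mulrBl => /eqP; rewrite eqe mulf_eq0 invr_eq0 pnatr_eq0 orbF.
  by rewrite -natrB// subSnn oner_eq0.
pose l k : Cplx R := lam (w' (cis t)) * ((phi (w' (cis t)))%:C + 'i * (b k t)%:C)
  - lam (w' (cis t)) * ((phi (w' (cis t)))%:C + 'i * (0 : R)%:C).
(* The same combination is zero inside the disk, so its limit along the radius, computed from the
   boundary values, is zero as well. *)
have L : (fun rho : R => \sum_(k < n.+1) (a k)%:C *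
    (F k (rho%:C * cis t) - F0 (rho%:C * cis t))) @ 1^'- -->
    (\sum_(k < n.+1) (a k)%:C * l k : Cplx R).
  by apply: cvg_linear_combination => k; exact: cvgB (tk k) t0.
have Z : (fun rho : R => \sum_(k < n.+1) (a k)%:C *
    (F k (rho%:C * cis t) - F0 (rho%:C * cis t))) @ 1^'- --> (0 : Cplx R).
  apply/cvg_nmP => e e0; near=> rho.
  have r0 : 0 <= rho by near: rho; apply: nbhs_left_ge; exact: ltr01.
  have r1 : rho < 1 by near: rho; exact: nbhs_left_lt.
  by rewrite comb0 ?subrr ?nm0// nmM nm_cis mulr1 nmR ger0_norm.
have sum0 : \sum_(k < n.+1) (a k)%:C * l k = 0 :> Cplx R.
  have U := @cvg_unique (Cplx R) (@norm_hausdorff _ _) ((fun rho : R =>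
    \sum_(k < n.+1) (a k)%:C * (F k (rho%:C * cis t) - F0 (rho%:C * cis t))) @ 1^'-) _.
  exact: U L Z.
have lE k : l k = lam (w' (cis t)) * ('i * (b k t)%:C).
  by rewrite /l -mulrBr opprD addrACA subrr add0r rmorph0 mulr0 subr0.
have [bj _] := boundary_inverse wD wcD w'K t.
have lam_t : nm (lam (w' (cis t))) = 1 by apply: norm1_nm; exact: lam1.
have bE k : b k t = (k == j :> nat)%:R.
  rewrite /b; congr (_%:R); congr nat_of_bool.
  apply/idP/eqP => [|->]; rewrite inE// => /IE/andP[h1 h2].
  move/IE : It => /andP[h3 h4].
  have h5 : (k < j.+1)%N by rewrite -(ltr_nat R) (lt_trans h1).
  have h6 : (j < k.+1)%N by rewrite -(ltr_nat R) (lt_trans h3).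
  by apply/eqP; rewrite eqn_leq -ltnS h5 -ltnS h6.
move: sum0; rewrite (bigD1 j)//= big1 => [|k kj]; last first.
  have kj' : (k == j :> nat) = false by exact: negbTE.
  by rewrite lE bE kj' rmorph0 !mulr0.
rewrite addr0 lE bE eqxx rmorph1 mulr1 => /(congr1 (fun z : R[i] => nm z))/eqP.
rewrite nm0 !nmM nmR lam_t mul1r mulf_eq0 normr_eq0 (negbTE aj)/=.
by rewrite nm_eq0 eq_complex/= oner_eq0 andbF.
Unshelve. all: by end_near. Qed.
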